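(* For every $\varepsilon\in(0,1)$ there exist positive constants $d_0=d_0(\varepsilon)$ and $D_0=D_0(\varepsilon)$ such that the following holds: if $G$ is an $n$-vertex $\Delta$-critical graph with minimum degree at least $d_0$ and maximum degree $\Delta(G)\ge D_0$, then $\alpha(G)<\left(\frac12+\varepsilon\right)n$.
   Context: All graphs are finite and simple. $\Delta(G)$ is the maximum degree, $\chi'(G)$ the chromatic index, and $\alpha(G)$ the independence number of $G$. A graph $G$ is $\Delta$-critical if $G$ is connected, $\chi'(G)=\Delta(G)+1$, and $\chi'(G-e)=\Delta(G)$ for every edge $e\in E(G)$. *)

(* Defs.v *)
From HB Require Import structures.
From mathcomp Require Import all_boot all_order all_algebra.
From mathcomp Require Import reals.

Set Implicit Arguments.
Unset Strict Implicit.
Unset Printing Implicit Defensive.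

Record sgraph (T : finType) := SGraph {
  adj :> rel T;
  adj_sym : symmetric adj;
  adj_irr : irreflexive adj
}.

Section Graphs.
Variable T : finType.
Implicit Types (G : sgraph T) (e f S : {set T}) (k : nat).

Definition edges G : {set {set T}} := [set [set x; y] | x in T, y in T & G x y].

Definition degree G (v : T) : nat := #|[set w | G v w]|.

Definition max_degree G : nat := \max_(v : T) degree G v.

(* Degrees are less than #|T|, so the neutral element #|T| does not affect the
   minimum as soon as there is a vertex. *)
Definition min_degree G : nat := \big[minn/#|T|]_(v : T) degree G v.

Definition independent G S : bool := [forall x in S, forall y in S, ~~ G x y].

Definition independence_number G : nat :=
  \max_(S : {set T} | independent G S) #|S|.

Definition connected_graph G : Prop :=
  0 < #|T| /\ forall x y : T, connect G x y.

(* Colourings are defined on the subtype of edges, so that an edgeless graph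
   is 0-edge-colourable. *)
Definition proper_edge_coloring G k
    (c : {ffun {e : {set T} | e \in edges G} -> 'I_k}) : bool :=
  [forall e, forall f,
     (e != f) && (val e :&: val f != set0) ==> (c e != c f)].

Definition edge_colorable G k : bool :=
  [exists c : {ffun {e : {set T} | e \in edges G} -> 'I_k},
     proper_edge_coloring c].

Lemma edge_colorable_ex G : exists k, edge_colorable G k.
Proof.
exists #|{: {e : {set T} | e \in edges G}}|.
apply/existsP; exists [ffun e => enum_rank e].
apply/forallP => e; apply/forallP => f; apply/implyP => /andP[ne_ef _].
by rewrite !ffunE (inj_eq enum_rank_inj).
Qed.

Definition chromatic_index G : nat := ex_minn (edge_colorable_ex G).

Definition del_edge_rel G e : rel T := [rel x y | G x y && ([set x; y] != e)].

Lemma del_edge_sym G e : symmetric (del_edge_rel G e).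
Proof. by move=> x y; rewrite /del_edge_rel /= adj_sym setUC. Qed.

Lemma del_edge_irr G e : irreflexive (del_edge_rel G e).
Proof. by move=> x; rewrite /del_edge_rel /= adj_irr. Qed.

Definition del_edge G e : sgraph T :=
  SGraph (@del_edge_sym G e) (@del_edge_irr G e).

Definition critical G : Prop :=
  [/\ connected_graph G,
      chromatic_index G = (max_degree G).+1 &
      forall e, e \in edges G -> chromatic_index (del_edge G e) = max_degree G].

End Graphs.

(* Main.v *)
Require Import Defs.
From mathcomp Require Import all_boot all_order all_algebra.
From mathcomp Require Import reals.
From mathcomp Require Import perm zify lra.

(** Let [S] be independent and call a vertex of [S] low if it misses at least
    [Delta / (E + 1)] colours, i.e. if its degree is at most
    [(1 - 1 / (E + 1)) Delta].  Counting the edges leaving [S] bounds the number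
    of vertices of [S] that are not low.  For the low ones, each [y] outside [S]
    splits a charge 1 evenly among its [k y] low neighbours, and it suffices that
    the sum of [1 / k y] over the neighbours [y] of a low [x] is at least [E].

    Otherwise [x] has a neighbour [y] with linearly many (in [deg x]) low
    neighbours such that most neighbours of [x] also have linearly many.  Colour
    [G - xy].  Up to boundedly many exceptions, the low neighbours [z] of [y] are
    joined to [y] by colours present at [x], as otherwise [y] is the centre of a
    Vizing fan containing [z].  So [z] determines the neighbour [u z] of [x] such
    that [x u] has the colour of [y z], and Kempe changes can make [x u] the
    uncoloured edge; hence low neighbours of [u z] also use colours present at
    [x], with few exceptions.  As [x] has only [deg x] colours, two vertices
    [u z1], [u z2] have low neighbours [w1], [w2] along the same colour, and this
    configuration is contradictory.

    Low vertices need not miss a common colour with [x].  But among many low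
    vertices three miss a common colour [c]; switching the colours [a], [c], with
    [a] missing at [x], on all chains not starting at [x] makes [a] missing at two
    of them. *)

Set Implicit Arguments.
Unset Strict Implicit.
Unset Printing Implicit Defensive.

(** * Two-coloured chains and Kempe changes *)

Section TwoInvolutions.
Variables (T : finType) (a b : T -> T).
Hypotheses (aK : involutive a) (bK : involutive b).

Let r : rel T := fun u v => (v == a u) || (v == b u).
Let p v := a (b v).

Lemma two_inv_connect_sym : connect_sym r.
Proof.
apply: sym_connect_sym => u v; rewrite /r.
by rewrite eq_sym (inv_eq aK) [v == b u]eq_sym (inv_eq bK).
Qed.

Let p_inj : injective p.
Proof. exact: inj_comp (can_inj aK) (can_inj bK). Qed.

(** [a] conjugates the rotation [p] to its inverse, so on the orbit of a fixed point [x] it acts as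
    a reflection about [x]. *)
Let a_iter i x : a x = x -> iter i p (a (iter i p x)) = x.
Proof.
move=> ax; elim: i => [|i IH] //.
by rewrite iterSr iterS {2 3}/p aK bK.
Qed.

Lemma iter_order_dvd k x : iter k p x = x -> fingraph.order p x %| k.
Proof.
move=> E; rewrite /dvdn; have n0 : 0 < fingraph.order p x by apply: fingraph.order_gt0.
have per j : iter (j * fingraph.order p x) p x = x.
  by elim: j => [|j IH] //; rewrite mulSn iterD IH fingraph.iter_order.
have E' : iter (k %% fingraph.order p x) p x = x.
  by rewrite -[RHS]E [in RHS](divn_eq k (fingraph.order p x)) addnC iterD per.
have /findex_iter := ltn_pmod k n0.
by rewrite E' findex0 => <-.
Qed.

(** The component of [x] is its [p]-orbit. If [y] is the [i]-th iterate, the order of the orbit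
    divides [2i] when [a y = y] and [2i + 1] when [b y = y]; since [0 < i] is below the order, it
    equals that number. So a chain with end [x] has at most one other end. *)
Let end_index x y : a x = x -> connect r x y -> y != x -> a y = y \/ b y = y ->
  y = iter (fingraph.order p x)./2 p x.
Proof.
move=> ax cxy nyx ey.
have {cxy} : fconnect p x y.
  case/connectP: cxy => q; elim/last_ind: q y {nyx ey} => [|q z IH] y /=.
    by move=> _ ->; exact: connect0.
  rewrite rcons_path last_rcons => /andP[pq /orP[]/eqP zE] ->; rewrite {}zE.
    have /iter_findex := IH _ pq erefl; move: (findex _ _ _) => i iE.
    rewrite -iE fconnect_sym //.
    by rewrite -[X in fconnect _ _ X](a_iter i ax); exact: fconnect_iter.
  have /iter_findex := IH _ pq erefl; move: (findex _ _ _) => i iE.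
  rewrite -iE -[b _]aK -/(p _) -iterS fconnect_sym //.
  by rewrite -[X in fconnect _ _ X](a_iter i.+1 ax); exact: fconnect_iter.
move=> fxy; have := iter_findex fxy; have := findex_max fxy.
move: (findex _ _ _) => i lti iE.
have i0 : 0 < i by case: i iE nyx {lti} => //= <-; rewrite eqxx.
suff : fingraph.order p x = i.*2 \/ fingraph.order p x = i.*2.+1.
  by case=> ->; rewrite /= ?uphalf_double ?doubleK iE.
case: ey => [ay|by_].
  left; have := a_iter i ax; rewrite iE ay -iE -iterD addnn.
  move=> /iter_order_dvd /dvdnP[j jE].
  have : j = 1.
    case: j jE => [|[|j]] //; first by rewrite mul0n => /eqP; rewrite double_eq0; case: i i0 {lti iE}.
    by rewrite !mulSn => jE; have := lti; rewrite -addnn in jE; lia.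
  by move=> j1; rewrite jE j1 mul1n.
right; have := a_iter i.+1 ax; rewrite [X in a X]iterS iE /p by_ aK -iE -iterD addSn addnn.
move=> /iter_order_dvd /dvdnP[j jE].
have : j = 1.
  case: j jE => [|[|j]] //; rewrite !mulSn => jE; have := lti; lia.
by move=> j1; rewrite jE j1 mul1n.
Qed.

Lemma two_inv_ends x y z : a x = x -> x != y -> x != z -> y != z ->
  a y = y \/ b y = y -> a z = z \/ b z = z ->
  connect r x y -> connect r x z -> False.
Proof.
move=> ax xy xz yz ey ez cy cz; move/eqP: yz; apply.
by rewrite (end_index ax cy _ ey) 1?eq_sym // (end_index ax cz _ ez) 1?eq_sym.
Qed.

End TwoInvolutions.

(** * Partial edge colourings as families of involutions *)

Section Matchings.
Variables (T K : finType) (G : rel T).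
Hypothesis G_irr : irreflexive G.
Implicit Types (m : K -> T -> T) (s : seq (T * T)) (S : {set T}).

(* A partial edge colouring is the family of its colour classes: [m c v] is the
   other end of the edge coloured [c] at [v], and [m c v = v] when [c] is
   missing at [v].  All edges but those listed in [s] have a colour; an edge may
   have several colours. *)
Definition coloring_but s m : Prop :=
  (forall c, involutive (m c)) /\
  (forall u v, G u v -> [|| (u, v) \in s, (v, u) \in s | [exists c, m c u == v]]).

Definition chain m (a b : K) (v : T) : {set T} :=
  [set w | connect (fun u w => (w == m a u) || (w == m b u)) v w].

Definition stable m (a b : K) S : Prop :=
  forall v, (m a v \in S) = (v \in S) /\ (m b v \in S) = (v \in S).

(** A Kempe change on several [(a, b)]-chains at once. When [S] is [stable], both ends of an edge
    coloured [a] or [b] lie on the same side of [S], so the classes remain matchings. *)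
Definition swap m (a b : K) S : K -> T -> T :=
  fun c v => m (if v \in S then tperm a b c else c) v.

(** Composing the class of [c] with a transposition inserts the edge [xy] if both ends miss [c] and
    deletes it if it has colour [c]. *)
Definition toggle m (c : K) (x y : T) : K -> T -> T :=
  fun d v => if d == c then tperm x y (m d v) else m d v.

Lemma chain_refl m a b v : v \in chain m a b v.
Proof. by rewrite inE connect0. Qed.

Lemma stable_chain m a b v : (forall c, involutive (m c)) ->
  stable m a b (chain m a b v).
Proof.
move=> mK w; have sym := two_inv_connect_sym (mK a) (mK b).
by split; rewrite !inE; apply/idP/idP => h; apply: (connect_trans h);
  rewrite ?(sym _ w); apply: connect1; rewrite eqxx ?orbT.
Qed.

Lemma chain_sym m a b v w : (forall c, involutive (m c)) ->
  (w \in chain m a b v) = (v \in chain m a b w).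
Proof. by move=> mK; rewrite !inE (two_inv_connect_sym (mK a) (mK b)). Qed.

Lemma stableC m a b S : stable m a b S -> stable m a b (~: S).
Proof. by move=> st v; case: (st v) => sa sb; rewrite !inE sa sb. Qed.

Lemma chain_eq m a b v w : (forall c, involutive (m c)) ->
  w \in chain m a b v -> chain m a b w = chain m a b v.
Proof.
move=> mK h; apply/setP=> u; move: h; rewrite !inE => h.
by rewrite (same_connect (two_inv_connect_sym (mK a) (mK b)) h).
Qed.

Lemma chain_ends m a b x y z : (forall c, involutive (m c)) ->
  x != y -> x != z -> y != z ->
  m a x = x \/ m b x = x -> m a y = y \/ m b y = y -> m a z = z \/ m b z = z ->
  y \in chain m a b x -> z \in chain m a b x -> False.
Proof.
move=> mK xy xz yz [ex|ex] ey ez; rewrite !inE => cy cz.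
  exact: (two_inv_ends (mK a) (mK b) ex xy xz yz ey ez cy cz).
apply: (two_inv_ends (mK b) (mK a) ex xy xz yz (y := y) (z := z)).
- by case: ey; [right | left].
- by case: ez; [right | left].
- by apply: etrans cy; apply: eq_connect => u w; rewrite orbC.
- by apply: etrans cz; apply: eq_connect => u w; rewrite orbC.
Qed.

Lemma swap_notin m a b S c v : v \notin S -> swap m a b S c v = m c v.
Proof. by rewrite /swap => /negbTE->. Qed.

Lemma swap_other m a b S c v : c != a -> c != b -> swap m a b S c v = m c v.
Proof. by move=> ca cb; rewrite /swap tpermD 1?eq_sym //; case: ifP. Qed.

Lemma swap_l m a b S v : v \in S -> swap m a b S a v = m b v.
Proof. by rewrite /swap => ->; rewrite tpermL. Qed.

Lemma swap_r m a b S v : v \in S -> swap m a b S b v = m a v.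
Proof. by rewrite /swap => ->; rewrite tpermR. Qed.

Lemma swap_coloring s m a b S : stable m a b S -> coloring_but s m ->
  coloring_but s (swap m a b S).
Proof.
move=> st [mK cov]; split=> [c v|u v /cov].
  rewrite /swap; case vS: (v \in S); last first.
    case: (boolP (m c v \in S)) => h; last by rewrite mK.
    case: tpermP => [ca|cb|]; last by rewrite mK.
      by move: h; rewrite ca (st v).1 vS.
    by move: h; rewrite cb (st v).2 vS.
  case: (boolP (m (tperm a b c) v \in S)) => [_|]; first by rewrite mK.
  have [sa sb] := st v.
  case: (tpermP a b c) => [_|_|_ _]; last by rewrite mK.
    by rewrite sb vS.
  by rewrite sa vS.
case/or3P=> [->//|->|/existsP[c /eqP cE]]; first by rewrite orbT.
apply/or3P; apply: Or33; apply/existsP; exists (if u \in S then tperm a b c else c).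
by rewrite /swap; case: (u \in S); rewrite ?tpermK cE.
Qed.

Lemma card_missing_swap m a b S v :
  #|[set c | swap m a b S c v == v]| = #|[set c | m c v == v]|.
Proof.
rewrite /swap; case: (v \in S) => //.
have inj : injective (tperm a b) by apply: perm_inj.
have <- : tperm a b @: [set c | m c v == v] = [set c | m (tperm a b c) v == v].
  apply/setP=> c; rewrite !inE; apply/imsetP/idP => [[d]|h].
    by rewrite inE => h ->; rewrite tpermK.
  by exists (tperm a b c); rewrite ?inE ?tpermK.
exact: card_imset.
Qed.

Lemma toggle_other m c x y d v : d != c -> toggle m c x y d v = m d v.
Proof. by rewrite /toggle => /negbTE->. Qed.

Lemma toggle_far m c x y d v : m c x = x /\ m c y = y \/ m c x = y ->
  (forall c, involutive (m c)) -> v != x -> v != y ->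
  toggle m c x y d v = m d v.
Proof.
move=> h mK vx vy; rewrite /toggle; case: eqP => // ->; apply: tpermD.
  apply/eqP=> E; have vE : v = m c x by rewrite E mK.
  case: h => [[h _]|h]; first by rewrite vE h eqxx in vx.
  by rewrite vE h eqxx in vy.
apply/eqP=> E; have vE : v = m c y by rewrite E mK.
case: h => [[_ h]|h]; first by rewrite vE h eqxx in vy.
by rewrite vE -h mK eqxx in vx.
Qed.

Lemma toggle_on m c x y : m c x = x -> m c y = y ->
  toggle m c x y c x = y /\ toggle m c x y c y = x.
Proof. by move=> hx hy; rewrite /toggle eqxx hx hy tpermL tpermR. Qed.

Lemma toggle_off m c x y : (forall c, involutive (m c)) -> m c x = y ->
  toggle m c x y c x = x /\ toggle m c x y c y = y.
Proof. by move=> mK hx; rewrite /toggle eqxx -hx mK tpermL tpermR. Qed.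

Lemma toggle_inv m c x y : m c x = x /\ m c y = y \/ m c x = y ->
  (forall c, involutive (m c)) -> forall d, involutive (toggle m c x y d).
Proof.
move=> h mK d v; rewrite /toggle; case: eqP => [->|_]; last exact: mK.
have cE w : m c (tperm x y w) = tperm x y (m c w).
  case: h => [[hx hy]|hx].
    case: tpermP => [->|->|/eqP wx /eqP wy]; rewrite ?hx ?hy ?tpermL ?tpermR //.
    rewrite tpermD // eq_sym.
      by rewrite -[X in _ != X]hx (inj_eq (can_inj (mK c))).
    by rewrite -[X in _ != X]hy (inj_eq (can_inj (mK c))).
  have hy : m c y = x by rewrite -hx mK.
  case: tpermP => [->|->|/eqP wx /eqP wy]; rewrite ?hx ?hy ?tpermL ?tpermR //.
  rewrite tpermD // eq_sym.
    by rewrite -[X in _ != X]hy (inj_eq (can_inj (mK c))).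
  by rewrite -[X in _ != X]hx (inj_eq (can_inj (mK c))).
by rewrite cE tpermK mK.
Qed.

Lemma uncolor s m c x y : coloring_but s m -> m c x = y -> x != y ->
  exists m', [/\ coloring_but ((x, y) :: s) m', m' c x = x, m' c y = y,
    forall d v, d != c -> m' d v = m d v &
    forall d v, v != x -> v != y -> m' d v = m d v].
Proof.
move=> [mK cov] cx xy; have h : m c x = x /\ m c y = y \/ m c x = y by right.
exists (toggle m c x y); have [-> ->] := toggle_off mK cx.
split=> // [|d v|d v vx vy]; [|exact: toggle_other|exact: toggle_far].
split=> [d|u v]; first exact: toggle_inv.
case/cov/or3P=> [|h1|/existsP[d /eqP dE]]; rewrite ?inE; first by move->; rewrite orbT.
  by rewrite h1 !orbT.
case: (eqVneq d c) => [E|dc]; last first.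
  apply/or3P; apply: Or33; apply/existsP; exists d; rewrite toggle_other ?dE //.
have [ux|ux] := eqVneq u x.
  by rewrite -dE E ux cx eqxx.
have [uy|uy] := eqVneq u y.
  by rewrite -dE E uy -cx mK eqxx !orbT.
by apply/or3P; apply: Or33; apply/existsP; exists d; rewrite toggle_far ?dE.
Qed.

Lemma color s m c x y : coloring_but ((x, y) :: s) m -> m c x = x -> m c y = y ->
  x != y ->
  exists m', [/\ coloring_but s m', m' c x = y, m' c y = x,
    forall d v, d != c -> m' d v = m d v &
    forall d v, v != x -> v != y -> m' d v = m d v].
Proof.
move=> [mK cov] cx cy xy; have h : m c x = x /\ m c y = y \/ m c x = y by left.
exists (toggle m c x y); have [tx ty] := toggle_on cx cy.
split=> // [|d v|d v vx vy]; [|exact: toggle_other|exact: toggle_far].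
split=> [d|u v Guv]; first exact: toggle_inv.
have [/andP[/eqP-> /eqP->]|n1] := boolP ((u == x) && (v == y)).
  by apply/or3P; apply: Or33; apply/existsP; exists c; rewrite tx.
have [/andP[/eqP-> /eqP->]|n2] := boolP ((v == x) && (u == y)).
  by apply/or3P; apply: Or33; apply/existsP; exists c; rewrite ty.
have := cov _ _ Guv; rewrite !inE !xpair_eqE (negbTE n1) (negbTE n2) /=.
case/or3P=> [->|->|/existsP[d /eqP dE]]; rewrite ?orbT //.
apply/or3P; apply: Or33; apply/existsP; exists d.
case: (eqVneq d c) => [E|dc]; last by rewrite toggle_other ?dE.
have [ux|ux] := eqVneq u x.
  by move: Guv; rewrite -dE E ux cx G_irr.
have [uy|uy] := eqVneq u y.
  by move: Guv; rewrite -dE E uy cy G_irr.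
by rewrite toggle_far ?dE.
Qed.

Lemma recolor s m b d y z : coloring_but s m -> m b y = z -> y != z ->
  m d y = y -> m d z = z ->
  exists m', [/\ coloring_but s m', [/\ m' b y = y, m' b z = z, m' d y = z & m' d z = y],
    forall c v, c != b -> c != d -> m' c v = m c v &
    forall c v, v != y -> v != z -> m' c v = m c v].
Proof.
move=> cm by_ yz dy dz.
have db : d != b by apply: contraNneq yz => E; rewrite -by_ -E dy.
have [m1 [c1 b1y b1z o1 f1]] := uncolor cm by_ yz.
have [||m2 [c2 d2y d2z o2 f2]] := color c1 (c := d) _ _ yz; rewrite ?o1 //.
exists m2; split=> // [|c v cb cd|c v vy vz]; last by rewrite f2 ?f1.
  by split=> //; rewrite o2 1?eq_sym.
by rewrite o2 ?o1.
Qed.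

(** Fan rotation at [x]: uncolouring [xu] frees [b] at [x], and [xy] takes it since [y] misses
    [b]. *)
Lemma move_uncolored x y u m b : coloring_but [:: (x, y)] m -> m b x = u -> m b y = y ->
  x != y -> x != u -> u != y ->
  exists m', [/\ coloring_but [:: (x, u)] m', [/\ m' b x = y, m' b y = x & m' b u = u],
    forall c v, c != b -> m' c v = m c v &
    forall c v, v != x -> v != y -> v != u -> m' c v = m c v].
Proof.
move=> cm bx by_ xy xu uy.
have [m1 [c1 b1x b1u o1 f1]] := uncolor cm bx xu.
have c1' : coloring_but [:: (x, y); (x, u)] m1.
  by case: c1 => mK cov; split=> // v w /cov; rewrite !inE => /or3P[/orP[]|/orP[]|] ->;
     rewrite ?orbT.
have [||m2 [c2 b2x b2y o2 f2]] := color c1' (c := b) _ _ xy => //.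
  by rewrite f1 // eq_sym.
exists m2; split=> // [|c v cb|c v vx vy vu]; last by rewrite f2 ?f1.
  by split=> //; rewrite f2 // eq_sym.
by rewrite o2 ?o1.
Qed.

(** * Vizing fans in a graph without a full colouring *)

Section Uncolorable.
Hypothesis no_coloring : forall m, ~ coloring_but [::] m.

(** Otherwise a Kempe change on the chain of [y] makes [a] missing at both ends of [xy], which can
    then be coloured. *)
Lemma linked x y m a d : coloring_but [:: (x, y)] m -> x != y ->
  m a x = x -> m d y = y -> y \in chain m a d x.
Proof.
move=> cm xy ax dy; case: (boolP (y \in _)) => // nyx; exfalso.
have [mK _] := cm; have st := stable_chain a d y mK.
have xny : x \notin chain m a d y by rewrite chain_sym.
have [||m' [c' _ _ _]] := color (swap_coloring st cm) (c := a) _ _ xy.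
- by rewrite swap_notin.
- by rewrite swap_l ?chain_refl.
by move/no_coloring: c'.
Qed.

(* The [(a, d)]-chain of [y] ends at [x], so it differs from that of [z]. *)
Lemma shift_missing x y z m a d : coloring_but [:: (x, y)] m -> x != y ->
  z != x -> z != y -> m a x = x -> m d y = y -> m a z = z ->
  exists m', [/\ coloring_but [:: (x, y)] m', m' d z = z,
    forall c v, c != a -> c != d -> m' c v = m c v,
    (forall c, m' c x = m c x) /\ (forall c, m' c y = m c y) &
    forall c v, v \notin chain m a d z -> m' c v = m c v].
Proof.
move=> cm xy zx zy ax dy az; have [mK _] := cm.
have yx := linked cm xy ax dy.
have xz : x \notin chain m a d z.
  apply/negP; rewrite chain_sym // => zxc.
  apply: (chain_ends mK xy _ _ _ _ _ yx zxc); rewrite 1?eq_sym //;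
    by [left | right].
have yz : y \notin chain m a d z.
  by apply: contra xz => h; rewrite -(chain_eq mK h) chain_sym.
exists (swap m a d (chain m a d z)); split.
- exact: swap_coloring (stable_chain _ _ _ mK) cm.
- by rewrite swap_r ?chain_refl.
- by move=> c v; exact: swap_other.
- by split=> c; exact: swap_notin.
- by move=> c v; exact: swap_notin.
Qed.

(** A Vizing fan at [y] with leaves [x] and [z]: a Kempe change makes [z] miss [d], then [yz] is
    recoloured [d] and [al] becomes free for [xy]. *)
Lemma fan_disjoint x y z m al et d : coloring_but [:: (x, y)] m -> x != y ->
  z != y -> m al x = x -> m al y = z -> m et x = x -> m et z = z -> m d y = y ->
  False.
Proof.
move=> cm xy zy alx aly etx etz dy; have [mK _] := cm.
have alz : m al z = y by rewrite -aly mK.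
have zx : z != x by apply: contraNneq xy => E; rewrite -alz E alx.
have ae : al != et by apply: contraNneq zy => E; rewrite -alz E etz.
have ad : al != d by apply: contraNneq zy => E; rewrite -aly E dy.
have [m1 [c1 dz1 o1 [x1 y1] _]] := shift_missing cm xy zx zy etx dy etz.
have [||||m2 [c2 [aly2 _ _ _] o2 f2]] := recolor c1 (b := al) (d := d) (y := y) (z := z).
- by rewrite o1.
- by rewrite eq_sym.
- by rewrite y1.
- by [].
have [|m3 [c3 _ _ _ _]] := color c2 (c := al) _ aly2 xy; last by move/no_coloring: c3.
by rewrite f2 ?x1 // eq_sym.
Qed.

(* If [y] has a neighbour [z] with the colour [b] of [xu] that shares a missing
   colour with [x], then [xu] can be made the uncoloured edge instead of [xy]. *)
Lemma fan_disjoint_next x y z u w m d a b al et :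
  coloring_but [:: (x, y)] m -> x != y -> u != x -> u != y -> z != x -> z != y ->
  w != u -> m d y = y -> m b y = z -> m b x = u ->
  m a x = x -> m a z = z -> m al x = x -> m al u = w ->
  m et x = x -> m et w = w -> a != al -> a != et -> False.
Proof.
move=> cm xy ux uy zx zy wu dy by_ bx ax az alx alu etx etw aal aet.
have [mK _] := cm.
(* If [x] missed [d] as well, [xy] could be coloured [d]; hence [d] differs from all colours missing
   at [x]. *)
have [dx|dx] := eqVneq (m d x) x.
  by have [m1 [/no_coloring]] := color cm dx dy xy.
have bd : b != d by apply: contraNneq zy => E; rewrite -by_ E dy.
have nb c : m c x = x -> c != b by apply: contra_eq_neq => ->; rewrite bx.
have nd c : m c x = x -> c != d by move=> h; apply: contraNneq dx => <-; rewrite h.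
(* Once [z] misses [d], recolouring [yz] with [d] makes [b] missing at [y]. Then [b] passes from
   [xu] to [xy], and there is a fan at [u] with leaves [x] and [w]. *)
have [m1 [c1 dz1 o1 [x1 y1] _]] := shift_missing cm xy zx zy ax dy az.
have [||||m2 [c2 [by2 _ _ _] o2 f2]] := recolor c1 (b := b) (d := d) (y := y) (z := z).
- by rewrite o1 // eq_sym nb.
- by rewrite eq_sym.
- by rewrite y1.
- by [].
have x2 c : m2 c x = m c x by rewrite f2 ?x1 // eq_sym.
have [|||m3 [c3 [_ _ bu3] o3 _]] :=
  move_uncolored c2 (u := u) (b := b) _ by2 xy _ _ => //.
- by rewrite x2.
- by rewrite eq_sym.
have E c v : c != d -> c != b -> c != a -> m3 c v = m c v.
  by move=> cd cb ca; rewrite o3 // o2 // o1.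
apply: (fan_disjoint c3 (z := w) (al := al) (et := et) (d := b)) => //.
- by rewrite eq_sym.
- by rewrite E ?nd ?nb // eq_sym.
- by rewrite E ?nd ?nb // eq_sym.
- by rewrite E ?nd ?nb // eq_sym.
- by rewrite E ?nd ?nb // eq_sym.
Qed.

End Uncolorable.
End Matchings.

(** * The forbidden configuration *)

Ltac ne := first [assumption | rewrite eq_sym; assumption].
Ltac split_uniq U := move: U; rewrite /= !inE !negb_or -?andbA;
  repeat (case/andP; let h := fresh "U" in intro h); intros _.

Section Siblings.
Variables (T K : finType) (G : rel T).
Hypothesis G_irr : irreflexive G.
Implicit Types (m : K -> T -> T) (s : seq (T * T)) (S : {set T}).
Hypothesis no_coloring : forall m, ~ coloring_but G [::] m.

Lemma coloring_butC e f m : coloring_but G [:: e; f] m -> coloring_but G [:: f; e] m.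
Proof.
by case=> mK cov; split=> // v w /cov; rewrite !inE => /or3P[/orP[]|/orP[]|] ->;
  rewrite ?orbT.
Qed.

(* A chain coloured [al], [g] starting at [x] reaches at most one of [u1], [u2];
   the edge to the other one can be coloured [al], and the remaining one creates a
   fan. *)
Lemma two_uncolored S x y u1 u2 z w1 w2 m b1 b2 g al e1 e2 :
  coloring_but G [:: (x, u1); (x, u2)] m ->
  [/\ y \notin S, u1 \notin S, u2 \notin S & [&& y != u1, y != u2 & u1 != u2]] ->
  [/\ x \in S, z \in S, w1 \in S & w2 \in S] ->
  uniq [:: b1; b2; g; al; e1; e2] ->
  [/\ m b1 x = x, m b1 u1 = w1 & m b1 y = z] ->
  [/\ m b2 x = y & m b2 u2 = w2] ->
  [/\ m g u1 = u1, m g u2 = u2 & m g w2 = w2] ->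
  [/\ m al x = x & m al w2 = w2] ->
  [/\ m e1 x = x & m e1 w1 = w1] ->
  [/\ m e2 x = x & m e2 z = z] -> False.
Proof.
move=> cm [yS u1S u2S /and3P[yu1 yu2 u12]] [xS zS w1S w2S] U [b1x b1u1 b1y] [b2x b2u2]
  [gu1 gu2 gw2] [alx alw2] [e1x e1w1] [e2x e2z].
have neS v w : v \notin S -> w \in S -> (v != w) /\ (w != v).
  by move=> h k; split; apply: contraNneq h => E; rewrite ?E // -E.
have [mK _] := cm.
have [yx xy] := neS _ _ yS xS; have [u1x xu1] := neS _ _ u1S xS.
have [u2x xu2] := neS _ _ u2S xS; have [u1w1 w1u1] := neS _ _ u1S w1S.
have [u2w2 w2u2] := neS _ _ u2S w2S; have [yz zy] := neS _ _ yS zS.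
have w2x : w2 != x by apply: contraNneq yu2 => E; rewrite -b2x -E -b2u2 mK.
split_uniq U.
case: (boolP (u2 \in chain m al g x)) => h.
  have nu1 : x \notin chain m al g u1.
    rewrite chain_sym //; apply/negP => h1.
    by apply: (chain_ends mK xu1 xu2 u12 _ _ _ h1 h); [left | right | right].
  have nu2 : u2 \notin chain m al g u1.
    by apply: contra nu1 => h1; rewrite -(chain_eq mK h1) chain_sym.
  have st := stable_chain al g u1 mK.
  have c1 := swap_coloring st cm.
  have [||m2 [c2 _ _ o2 f2]] := color G_irr c1 (c := al) _ _ xu1.
  - by rewrite swap_notin.
  - by rewrite swap_l ?chain_refl.
  have o c v : c != al -> c != g -> m2 c v = m c v.
    by move=> ca cg; rewrite o2 // swap_other.
  (* [w2] misses both [al] and [g], so it still misses [g] whether or not the change reached it.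
     Recolouring [u2w2] with [g] frees [b2] at [u2]; the uncoloured edge then moves back to [xy],
     where [z] gives a fan at [y]. *)
  have [||||m3 [c3 [b2u2' _ _ _] o3 f3]] := recolor G_irr c2 (b := b2) (d := g) (y := u2) (z := w2).
  - by rewrite o //; ne.
  - by [].
  - by rewrite o2 ?swap_notin //; ne.
  - rewrite o2; last by ne.
    by rewrite /swap tpermR; case: ifP.
  have [|m4 [c4 [_ _ b2y] o4 _]] := move_uncolored G_irr c3 (u := y) (b := b2) _ b2u2' xu2 xy yu2.
    by rewrite f3 ?o //; ne.
  have o' c v : c != b2 -> c != al -> c != g -> m4 c v = m c v.
    by move=> cb ca cg; rewrite o4 // o3 // o.
  apply: (fan_disjoint G_irr no_coloring c4 xy zy (al := b1) (et := e2) (d := b2)) => //;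
    rewrite o' //; ne.
have nx : x \notin chain m al g u2 by rewrite chain_sym.
have st := stable_chain al g u2 mK.
have c1 := coloring_butC (swap_coloring st cm).
have [||m2 [c2 _ _ o2 f2]] := color G_irr c1 (c := al) _ _ xu2.
- by rewrite swap_notin.
- by rewrite swap_l ?chain_refl.
have o c v : c != al -> c != g -> m2 c v = m c v.
  by move=> ca cg; rewrite o2 // swap_other.
(* The change may have reached [u1], but either way [u1] misses one of [al] and [g], which is all
   the fan at [u1] requires. *)
have [d du1] : exists d, m2 d u1 = u1.
  case: (boolP (u1 \in chain m al g u2)) => h1.
    by exists al; rewrite f2 // swap_l.
  by exists g; rewrite f2 // swap_notin.
apply: (fan_disjoint G_irr no_coloring c2 xu1 w1u1 (al := b1) (et := e1) (d := d)) => //;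
  rewrite o //; ne.
Qed.

(** Reduction to [two_uncolored]: [yz2] gets [b3], so that [xy] can take [b2] from [xu2]; then
    [u2w2] gets [b2], [xu1] loses [b1] and [u1w1] gets [b1]. This leaves [xu1] and [xu2] uncoloured
    and [g] missing at [u1], [u2] and [w2]. *)
Lemma siblings_end S x y u1 u2 z2 z3 w1 w2 m b1 b2 b3 g a2 a4 a5 a6 a7 :
  coloring_but G [:: (x, y)] m ->
  [/\ y \notin S, u1 \notin S, u2 \notin S & [&& y != u1, y != u2 & u1 != u2]] ->
  [/\ x \in S, z2 \in S, z3 \in S & (w1 \in S) && (w2 \in S)] ->
  [/\ w1 != w2, w1 != x, w2 != x & z2 != x] ->
  uniq [:: b1; b2; b3; g; a2; a4; a5; a6; a7] ->
  [/\ m b1 y = z3, m b2 y = z2 & m b3 y = y] ->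
  [/\ m b1 x = u1, m b2 x = u2, m g u1 = w1, m g u2 = w2 & m b1 w1 = w1] ->
  [/\ m a2 x = x & m a2 z2 = z2] ->
  [/\ m a4 x = x & m a4 w2 = w2] ->
  [/\ m a5 x = x & m a5 w2 = w2] ->
  [/\ m a6 x = x & m a6 w1 = w1] ->
  [/\ m a7 x = x & m a7 z3 = z3] -> False.
Proof.
move=> cm sideW [xS z2S z3S /andP[w1S w2S]] [w12 w1x w2x z2x] U [b1y b2y b3y] [b1x b2x gu1 gu2 b1w1]
  [a2x a2z2] [a4x a4w2] [a5x a5w2] [a6x a6w1] [a7x a7z3].
have [yS u1S u2S /and3P[yu1 yu2 u12]] := sideW.
have neS v w : v \notin S -> w \in S -> (v != w) /\ (w != v).
  by move=> h k; split; apply: contraNneq h => E; rewrite ?E // -E.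
have [mK _] := cm.
have [yx xy] := neS _ _ yS xS; have [u1x xu1] := neS _ _ u1S xS.
have [u2x xu2] := neS _ _ u2S xS; have [u1w1 w1u1] := neS _ _ u1S w1S.
have [u2w2 w2u2] := neS _ _ u2S w2S; have [yz2 z2y] := neS _ _ yS z2S.
have [yw1 w1y] := neS _ _ yS w1S.
have [u2w1 w1u2] := neS _ _ u2S w1S; have [u1w2 w2u1] := neS _ _ u1S w2S.
split_uniq U.
have [m1 [c1 b3z2 o1 [x1 y1] _]] := shift_missing G_irr no_coloring cm xy z2x z2y a2x b3y a2z2.
have [||||m2 [c2 [b2y' _ _ _] o2 f2]] := recolor G_irr c1 (b := b2) (d := b3) (y := y) (z := z2).
- by rewrite y1.
- by [].
- by rewrite y1.
- by [].
have [||m3 [c3 [b2x' b2y2 b2u2] o3 _]] := move_uncolored G_irr c2 (u := u2) (b := b2) _ b2y' xy xu2.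
- by rewrite f2 ?x1 //; ne.
- by ne.
have O3 c v : c != a2 -> c != b3 -> c != b2 -> m3 c v = m c v.
  by move=> h1 h2 h3; rewrite o3 // o2 // o1.
have [||m4 [c4 b2w2 o4 [x4 u4] _]] :=
  shift_missing G_irr no_coloring c3 xu2 w2x w2u2 (a := a4) _ b2u2.
- by rewrite O3 //; ne.
- by rewrite O3 //; ne.
have O4 c v : c != a2 -> c != b3 -> c != b2 -> c != a4 -> m4 c v = m c v.
  by move=> h1 h2 h3 h4; rewrite o4 // O3.
have [||||m5 [c5 [gu2' gw2 b2u2' _] o5 f5]] :=
  recolor G_irr c4 (b := g) (d := b2) (y := u2) (z := w2).
- by rewrite O4 //; ne.
- by [].
- by rewrite u4.
- by [].
have O5 c v : c != a2 -> c != b3 -> c != b2 -> c != a4 -> c != g -> m5 c v = m c v.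
  by move=> h1 h2 h3 h4 h5; rewrite o5 // O4.
have [||m6 [c6 b1x' b1u1 o6 f6]] := uncolor c5 (c := b1) (x := x) (y := u1).
- by rewrite O5 //; ne.
- by [].
have [||||m7 [c7 [gu1' _ b1u1' _] o7 f7]] :=
  recolor G_irr c6 (b := g) (d := b1) (y := u1) (z := w1).
- by rewrite o6 ?f5 ?O4 //; ne.
- by [].
- by [].
- by rewrite f6 ?O5 //; ne.
have O7 c v : c != a2 -> c != b3 -> c != b2 -> c != a4 -> c != g -> c != b1 -> m7 c v = m c v.
  by move=> h1 h2 h3 h4 h5 h6; rewrite o7 // o6 // O5.
apply: (two_uncolored (S := S) (y := y) (z := z3) (w1 := w1) (w2 := w2) (b1 := b1)
  (b2 := b2) (g := g) (al := a5) (e1 := a6) (e2 := a7) c7) => //.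
- rewrite /= !inE !negb_or -!andbA; do ! (apply/andP; split) => //; ne.
- split=> //.
    by rewrite f7 //; ne.
  by rewrite f7 ?f6 ?O5 //; ne.
- split; rewrite o7 ?o6 //; try ne.
  by rewrite f5 ?x4 //; ne.
- split=> //; rewrite f7 ?o6 //; ne.
- by split; rewrite O7 //; ne.
- by split; rewrite O7 //; ne.
- by split; rewrite O7 //; ne.
Qed.


(* Two candidates [z3], [z4] sharing [a] are needed: [z3] and [w1] both have to
   miss [b1], and a chain coloured [a], [b1] from [w1] spoils only one of them. *)
Lemma siblings S x y u1 u2 z1 z2 z3 z4 w1 w2 m d b1 b2 b3 b4 g a1 a2 a3 a4 a5 a6 a7 a8 a :
  coloring_but G [:: (x, y)] m ->
  [/\ y \notin S, u1 \notin S, u2 \notin S & [&& y != u1, y != u2 & u1 != u2]] ->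
  [/\ x \in S, (z1 \in S) && (z2 \in S), (z3 \in S) && (z4 \in S)
    & (w1 \in S) && (w2 \in S)] ->
  [/\ w1 != w2, w1 != x, w2 != x & z2 != x] ->
  [/\ z1 != x, z3 != x, z4 != x & [&& z3 != z4, z3 != w1 & z4 != w1]] ->
  uniq [:: d; b1; b2; b3; g; a; a1; a2; a3; a4; a5; a6; a7] ->
  uniq [:: d; b1; b2; b4; g; a; a1; a2; a3; a4; a5; a6; a8] ->
  [/\ m d y = y, m b1 y = z1, m b2 y = z2, m b3 y = z3 & m b4 y = z4] ->
  [/\ m b1 x = u1, m b2 x = u2, m g u1 = w1 & m g u2 = w2] ->
  [/\ m a1 x = x & m a1 z1 = z1] ->
  [/\ m a2 x = x & m a2 z2 = z2] ->
  [/\ m a3 x = x & m a3 w1 = w1] ->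
  [/\ m a4 x = x & m a4 w2 = w2] ->
  [/\ m a5 x = x & m a5 w2 = w2] ->
  [/\ m a6 x = x & m a6 w1 = w1] ->
  [/\ m a7 x = x & m a7 z3 = z3] ->
  [/\ m a8 x = x & m a8 z4 = z4] ->
  [/\ m a x = x, m a z3 = z3 & m a z4 = z4] -> False.
Proof.
move=> cm sideW [xS /andP[z1S z2S] /andP[z3S z4S] /andP[w1S w2S]].
move=> nW [z1x z3x z4x /and3P[z34 z3w1 z4w1]] U U' [dy b1y b2y b3y b4y] [b1x b2x gu1 gu2].
move=> [a1x a1z1] [a2x a2z2] [a3x a3w1] [a4x a4w2] [a5x a5w2] [a6x a6w1] [a7x a7z3]
  [a8x a8z4] [ax az3 az4].
have [yS u1S u2S /and3P[yu1 yu2 u12]] := sideW.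
have [w12 w1x w2x z2x] := nW.
have neS v w : v \notin S -> w \in S -> (v != w) /\ (w != v).
  by move=> h k; split; apply: contraNneq h => E; rewrite ?E // -E.
have [yx xy] := neS _ _ yS xS; have [yz1 z1y] := neS _ _ yS z1S.
have [yw1 w1y] := neS _ _ yS w1S; have [yz3 z3y] := neS _ _ yS z3S.
have [yz4 z4y] := neS _ _ yS z4S.
(* Recolouring [yz1] with [d] makes [b1] missing at [y]; a Kempe change through [a3] then makes [b1]
   missing at [w1] too. *)
have [m3 [c3 b1w1 x3 b1y3 [y3 O3]]] : exists m3, [/\ coloring_but G [:: (x, y)] m3,
    m3 b1 w1 = w1, (forall c, m3 c x = m c x), m3 b1 y = y &
    (forall c, c != a1 -> c != d -> c != b1 -> m3 c y = m c y) /\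
    (forall c v, c != a1 -> c != d -> c != b1 -> c != a3 -> m3 c v = m c v)].
  clear U'; split_uniq U.
  have [m1 [c1 dz1 o1 [x1 y1] _]] := shift_missing G_irr no_coloring cm xy z1x z1y a1x dy a1z1.
  have [||||m2 [c2 [b1y' _ _ _] o2 f2]] := recolor G_irr c1 (b := b1) (d := d) (y := y) (z := z1).
  - by rewrite y1.
  - by [].
  - by rewrite y1.
  - by [].
  have [||m3 [c3 b1w1 o3 [x3 y3] _]] :=
    shift_missing G_irr no_coloring c2 xy w1x w1y (a := a3) _ b1y'.
  - by rewrite o2 ?o1 //; ne.
  - by rewrite o2 ?o1 //; ne.
  exists m3; split=> //.
  - by move=> c; rewrite x3 f2 ?x1 //; ne.
  - by rewrite y3.
  split=> [c ca cd cb|c v ca cd cb ca3].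
    by rewrite y3 o2 ?y1.
  by rewrite o3 // o2 // o1.
have [mK _] := c3.
(* A Kempe change on the [(a, b1)]-chain of [z] makes [z] miss [b1]; [w1] is off that chain and
   still misses it. Giving [b1] to [yz] frees [b] at [y]. *)
have finish z b a' : uniq [:: d; b1; b2; b; g; a; a1; a2; a3; a4; a5; a6; a'] ->
    z \in S -> z != x -> z != w1 -> m b y = z -> m a z = z -> m a' x = x -> m a' z = z ->
    w1 \notin chain m3 a b1 z -> False.
  move=> {U U'} U zS zx zw1 bY az a'x a'z nz.
  have [yz zy] := neS _ _ yS zS.
  split_uniq U.
  have [||m4 [c4 b1z o4 [x4 y4] n4]] :=
    shift_missing G_irr no_coloring c3 xy zx zy (a := a) _ b1y3.
  - by rewrite x3.
  - by rewrite O3 //; ne.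
  have [||||m5 [c5 [bY' _ b1Y _] o5 f5]] :=
    recolor G_irr c4 (b := b) (d := b1) (y := y) (z := z).
  - by rewrite y4 y3 //; ne.
  - by [].
  - by rewrite y4.
  - by [].
  have x5 c : m5 c x = m c x by rewrite f5 ?x4 //; ne.
  have O5 c v : c != a1 -> c != d -> c != b1 -> c != a3 -> c != a -> c != b ->
      m5 c v = m c v.
    by move=> h1 h2 h3 h4 h5 h6; rewrite o5 // o4 // O3.
  apply: (siblings_end (S := S) (y := y) (u1 := u1) (u2 := u2) (z2 := z2) (z3 := z)
    (w1 := w1) (w2 := w2) (b1 := b1) (b2 := b2) (b3 := b) (g := g)
    (a2 := a2) (a4 := a4) (a5 := a5) (a6 := a6) (a7 := a') c5) => //;
    rewrite ?x5.
  - by rewrite w1S w2S.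
  - rewrite /= !inE !negb_or -!andbA; do ! (apply/andP; split) => //; ne.
  - by split=> //; rewrite O5 //; ne.
  - split=> //; try by rewrite O5 //; ne.
    rewrite f5 ?n4 //; ne.
  - by split=> //; rewrite O5 //; ne.
  - by split=> //; rewrite O5 //; ne.
  - by split=> //; rewrite O5 //; ne.
  - by split=> //; rewrite O5 //; ne.
  - by split=> //; rewrite O5 //; ne.
case: (boolP (w1 \in chain m3 a b1 z3)) => [h3|]; last exact: (finish z3 b3 a7).
case: (boolP (w1 \in chain m3 a b1 z4)) => [h4|]; last exact: (finish z4 b4 a8).
clear finish U'; split_uniq U.
apply: (chain_ends mK (x := w1) (y := z3) (z := z4) (a := a) (b := b1)) => //.
- by rewrite eq_sym.
- by rewrite eq_sym.
- by right.
- by left; rewrite O3 //; ne.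
- by left; rewrite O3 //; ne.
- by rewrite chain_sym.
- by rewrite chain_sym.
Qed.

End Siblings.

(** * Making low vertices share missing colours with [x] *)

Section Sharing.
Variables (T K : finType) (G : rel T) (s : seq (T * T)) (x : T) (e : nat).
Implicit Types (m : K -> T -> T) (P : {set K}) (Y B : {set T}).

Definition missing m v : {set K} := [set c | m c v == v].

(** [P] holds the colours whose edges must survive further Kempe changes. The numbers of missing
    colours are kept so that low vertices can be used again. *)
Definition refines P m m' : Prop :=
  [/\ coloring_but G s m', forall c v, c \in P -> m' c v = m c v,
      forall c, m' c x = m c x & forall v, #|missing m' v| = #|missing m v|].

Lemma refines_trans P P' m m1 m2 : P \subset P' ->
  refines P m m1 -> refines P' m1 m2 -> refines P m m2.
Proof.
move=> sP [_ o1 x1 k1] [c2 o2 x2 k2]; split=> // [c v cP|c|v].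
- by rewrite o2 ?o1 // (subsetP sP).
- by rewrite x2.
- by rewrite k2.
Qed.

Lemma sum_missing m P Y :
  \sum_(c in ~: P) #|[set z in Y | m c z == z]| = \sum_(z in Y) #|missing m z :\: P|.
Proof.
rewrite (eq_bigr (fun c => \sum_(z in Y) (m c z == z))); last first.
  move=> c _; rewrite -sum1_card big_mkcond [RHS]big_mkcond /=.
  by apply: eq_bigr => z _; rewrite inE; case: (z \in Y); case: eqP.
rewrite exchange_big /=; apply: eq_bigr => z _.
rewrite -sum1_card big_mkcond [RHS]big_mkcond /=.
by apply: eq_bigr => c _; rewrite !inE; case: (c \in P); case: eqP.
Qed.

(** Double counting: each of the at least [4 * e] vertices misses more than [#|K| / (2 * e)] colours
    outside [P], whereas at most two vertices per colour would give at most [2 * #|K|] pairs. *)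
Lemma popular_missing m P Y : 0 < e -> (forall z, z \in Y -> #|K| <= e * #|missing m z|) ->
  4 * e <= #|Y| -> 2 * e * #|P| < #|K| ->
  exists2 c, c \notin P & 2 < #|[set z in Y | m c z == z]|.
Proof.
move=> e0 missY cY cP.
case: (boolP [exists c in ~: P, 2 < #|[set z in Y | m c z == z]|]).
  by case/exists_inP=> c; rewrite inE; exists c.
rewrite negb_exists_in => /forall_inP few; exfalso.
have up : \sum_(z in Y) #|missing m z :\: P| <= 2 * #|K|.
  rewrite -sum_missing; apply: (@leq_trans (\sum_(c in ~: P) 2)).
    by apply: leq_sum => c /few; rewrite -leqNgt.
  by rewrite sum_nat_const mulnC leq_mul2l max_card.
have low : #|Y| * #|K| <= e * (\sum_(z in Y) #|missing m z :\: P| + #|Y| * #|P|).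
  rewrite -!sum_nat_const -big_split big_distrr /=; apply: leq_sum => z zY.
  apply: leq_trans (missY z zY) _; rewrite leq_mul2l; apply/orP; right.
  by rewrite -(cardsID P) addnC leq_add2l subset_leq_card ?subsetIr.
have h1 : #|Y| * #|K| <= e * (2 * #|K|) + #|Y| * (e * #|P|).
  by apply: leq_trans low _; rewrite mulnDr leq_add ?leq_mul2l ?up ?orbT // mulnCA.
have h2 : #|Y| * (2 * (e * #|P|)).+1 <= #|Y| * #|K| by rewrite leq_mul2l mulnA cP orbT.
have h3 : 4 * e * #|K| <= #|Y| * #|K| by rewrite leq_mul2r cY orbT.
nia.
Qed.

(** Let three vertices of [Y] miss [c]. The [(a, c)]-chain of [x], where [x] misses [a], has at most
    one end besides [x], so two of the three are off it. Switching off this chain leaves the colours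
    at [x] alone and makes both miss [a]. *)
Lemma share_common m P Y : coloring_but G s m -> x \notin Y ->
  (forall z, z \in Y -> #|K| <= e * #|missing m z|) -> #|K| <= e * #|missing m x| ->
  4 * e <= #|Y| -> 2 * e * #|P| < #|K| ->
  exists m' z z' a, [/\ refines P m m', [/\ z \in Y, z' \in Y & z != z'], a \notin P
    & [/\ m' a x = x, m' a z = z & m' a z' = z']].
Proof.
move=> cm xY missY missx cY cP; have [mK _] := cm.
have e0 : 0 < e.
  by rewrite lt0n; apply: contraTneq cP => E; rewrite -leqNgt (leq_trans missx) // E.
have [c cnP c3] := popular_missing e0 missY cY cP.
have [cx|cx] := eqVneq (m c x) x.
  have /card_gt1P[z [z' [+ + zz]]] := ltnW c3.
  rewrite !inE => /andP[zY /eqP cz] /andP[z'Y /eqP cz'].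
  by exists m, z, z', c.
have [a] : exists a, a \in missing m x :\: P.
  apply/set0Pn; apply: contraTneq cP => E; rewrite -leqNgt.
  have h : #|missing m x| <= #|P| by rewrite subset_leq_card // -setD_eq0 E.
  by apply: leq_trans missx _; rewrite -mulnA mul2n -addnn -[X in X <= _]addn0 leq_add ?leq_mul2l ?h ?orbT.
rewrite !inE => /andP[anP /eqP ax].
have st := stableC (stable_chain a c x mK).
have : 1 < #|[set z in Y | m c z == z] :\: chain m a c x|.
  rewrite cardsD; suff : #|[set z in Y | m c z == z] :&: chain m a c x| <= 1 by lia.
  rewrite leqNgt; apply/negP => /card_gt1P[z [z' []]].
  move=> /setIP[+ hz] /setIP[+ hz'] zz.
  rewrite !in_set => /andP[zY /eqP cz] /andP[z'Y /eqP cz'].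
  apply: (@chain_ends _ _ m a c x z z') => //; try by [left | right];
    by apply: contraNneq xY => ->.
case/card_gt1P=> z [z' [/setDP[+ hz] /setDP[+ hz'] zz]].
rewrite !in_set => /andP[zY /eqP cz] /andP[z'Y /eqP cz'].
exists (swap m a c (~: chain m a c x)), z, z', a.
split=> //; last by rewrite swap_notin ?in_setC ?negbK ?chain_refl // !swap_l ?in_setC.
split=> [|d v dP|d|v].
- exact: swap_coloring.
- by rewrite swap_other //; apply: contraTneq dP => ->.
- by rewrite swap_notin // in_setC negbK chain_refl.
- exact: card_missing_swap.
Qed.

(** [share_common] is applied repeatedly: each time one vertex is served and its colour is added to
    [P]. Fewer than [4 * e] remaining vertices form the exceptional set [B]. *)
Lemma share_one m P Y : coloring_but G s m -> x \notin Y ->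
  (forall z, z \in Y -> #|K| <= e * #|missing m z|) -> #|K| <= e * #|missing m x| ->
  2 * e * (#|P| + #|Y|) < #|K| ->
  exists m' f B, [/\ refines P m m', #|B| <= 4 * e &
    forall z, z \in Y :\: B -> [/\ f z \notin P, m' (f z) x = x & m' (f z) z = z]].
Proof.
move: {2}#|Y| (leqnn #|Y|) => k; elim: k m P Y => [|k IH] m P Y lek cm xY missY missx small.
  have Y0 : Y = set0 by apply/eqP; rewrite -cards_eq0 -leqn0.
  have /card_gt0P[c _] : 0 < #|K| by apply: leq_ltn_trans small.
  exists m, (fun=> c), set0; split=> //; first by rewrite cards0.
  by move=> z; rewrite Y0 !inE.
have [ltY|leY] := ltnP #|Y| (4 * e).
  have /card_gt0P[c _] : 0 < #|K| by apply: leq_ltn_trans small.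
  exists m, (fun=> c), Y; split=> //; first exact: ltnW.
  by move=> z; rewrite setDv !inE.
have [|m1 [z [_ [a [r1 [zY _ _] anP [ax az _]]]]]] := share_common cm xY missY missx leY (P := P).
  by apply: leq_ltn_trans small; rewrite leq_mul2l leq_addr orbT.
have [c1 o1 x1 k1] := r1.
have [|||||m2 [f [B [r2 cB fP]]]] := IH m1 (a |: P) (Y :\ z) _ c1.
- by move: lek; rewrite (cardsD1 z) zY.
- by rewrite !inE (negbTE xY) andbF.
- by move=> v; rewrite !inE k1 => /andP[_ /missY].
- by rewrite k1.
- by move: small; rewrite (cardsD1 z Y) zY cardsU1 anP; congr (_ * _ < _); lia.
have [c2 o2 x2 k2] := r2.
exists m2, (fun v => if v == z then a else f v), B; split=> //.
  exact: refines_trans (subsetUr _ _) r1 r2.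
move=> v; rewrite inE => /andP[vB vY]; case: eqVneq => [->|vz].
  by rewrite x2 o2 ?setU11.
have [|fnP fx fz] := fP v; first by rewrite !inE vB vz.
by split=> //; apply: contra fnP => h; rewrite inE h orbT.
Qed.

(** The colours chosen in one round join [P], so later rounds neither reuse nor disturb them. *)
Lemma share_many r m P Y : coloring_but G s m -> x \notin Y ->
  (forall z, z \in Y -> #|K| <= e * #|missing m z|) -> #|K| <= e * #|missing m x| ->
  2 * e * (#|P| + r * #|Y|) < #|K| ->
  exists m' f B, [/\ refines P m m', #|B| <= r * (4 * e),
    forall i z, i < r -> z \in Y :\: B ->
      [/\ f i z \notin P, m' (f i z) x = x & m' (f i z) z = z] &
    forall i j z z', i < j < r -> z \in Y :\: B -> z' \in Y :\: B -> f i z != f j z'].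
Proof.
elim: r m P => [|r IH] m P cm xY missY missx small.
  have /card_gt0P[c _] : 0 < #|K| by apply: leq_ltn_trans small.
  exists m, (fun _ _ => c), set0; split=> //; first by rewrite cards0.
  by move=> i j z z'; rewrite ltn0 andbF.
have [|m1 [f0 [B0 [r1 cB0 fP0]]]] := share_one cm xY missY missx (P := P).
  by apply: leq_ltn_trans small; rewrite leq_mul2l mulSn leq_add2l leq_addr orbT.
have [c1 o1 x1 k1] := r1.
have [|||m2 [f [B [r2 cB fP fI]]]] := IH m1 (P :|: f0 @: Y) c1 xY.
- by move=> z /missY; rewrite k1.
- by rewrite k1.
- apply: leq_ltn_trans small; rewrite leq_mul2l mulSn; apply/orP; right.
  have := (leq_card_setU P (f0 @: Y)).1; have : #|f0 @: Y| <= #|Y| := leq_imset_card _ _; lia.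
have [c2 o2 x2 k2] := r2.
exists m2, (fun i => if i is j.+1 then f j else f0), (B0 :|: B); split.
- exact: refines_trans (subsetUl _ _) r1 r2.
- by rewrite (leq_trans (leq_card_setU _ _)) // mulSn leq_add.
- move=> [|i] z; rewrite ltnS => ir; rewrite !inE negb_or -andbA => /and3P[zB0 zB zY].
    have [|h1 h2 h3] := fP0 z; first by rewrite inE zB0.
    by rewrite x2 x1 -{1}x1 h2 o2 // inE imset_f ?orbT.
  have [|h1 h2 h3] := fP i z ir; first by rewrite inE zB.
  by split=> //; apply: contra h1; rewrite inE => ->.
- move=> [|i] [|j] z z' //=; rewrite ?ltnS => ij; rewrite !inE !negb_or -!andbA;
    move=> /and3P[zB0 zB zY] /and3P[z'B0 z'B z'Y].
    have [|h _ _] := fP j z' ij; first by rewrite inE z'B.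
    by apply: contraNneq h => <-; rewrite inE imset_f ?orbT.
  by apply: fI; rewrite ?inE ?zB ?z'B.
Qed.

End Sharing.

(** * Finding the configuration *)

Lemma exists_subset_card (T : finType) (A : {set T}) k : k <= #|A| ->
  exists2 B : {set T}, B \subset A & #|B| = k.
Proof.
move=> kA; exists [set v in take k (enum A)].
  by apply/subsetP => v; rewrite inE => /mem_take; rewrite mem_enum.
rewrite cardsE (card_uniqP _) ?take_uniq ?enum_uniq // size_take -cardE.
by case: ltngtP kA.
Qed.

Lemma card_bigcup_le (I T : finType) (A : {set I}) (F : I -> {set T}) :
  #|\bigcup_(i in A) F i| <= \sum_(i in A) #|F i|.
Proof.
apply: (big_ind2 (fun (X : {set T}) k => #|X| <= k)); first by rewrite cards0.
  by move=> X k Y l Xk Yl; rewrite (leq_trans (leq_card_setU _ _)) // leq_add.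
by [].
Qed.

Lemma popular_color (T K : finType) (A : {set T}) (C : {set K}) (F : T -> {set K}) k h :
  (forall z, z \in A -> F z \subset C) -> (forall z, z \in A -> k <= #|F z|) ->
  h * #|C| < #|A| * k -> exists2 c, c \in C & h < #|[set z in A | c \in F z]|.
Proof.
move=> sF kF big.
case: (boolP [exists c in C, h < #|[set z in A | c \in F z]|]).
  by case/exists_inP=> c; exists c.
rewrite negb_exists_in => /forall_inP few; move: big; rewrite ltnNge; case/negP.
apply: (@leq_trans (\sum_(z in A) #|F z|)).
  by rewrite -sum_nat_const; apply: leq_sum.
apply: (@leq_trans (\sum_(c in C) #|[set z in A | c \in F z]|)); last first.
  by rewrite mulnC -sum_nat_const; apply: leq_sum => c /few; rewrite -leqNgt.
rewrite [X in _ <= X](eq_bigr (fun c => \sum_(z in A) (c \in F z))); last first.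
  move=> c _; rewrite -sum1_card big_mkcond [RHS]big_mkcond /=.
  by apply: eq_bigr => z _; rewrite inE; case: (z \in A); case: (c \in F z).
rewrite exchange_big /=; apply: leq_sum => z zA.
rewrite -sum1_card big_mkcond [X in _ <= X]big_mkcond /=; apply: leq_sum => c _.
by case: (boolP (c \in F z)) => // /(subsetP (sF z zA)) ->.
Qed.

Section Counting.
Variables (T K : finType) (G : rel T) (S : {set T}) (L : T -> {set T}).
Variables (x y : T) (d : K) (m : K -> T -> T) (e : nat).
Hypothesis G_irr : irreflexive G.
Hypothesis no_coloring : forall m' : K -> T -> T, ~ coloring_but G [::] m'.
Hypothesis cm : coloring_but G [:: (x, y)] m.
Hypotheses (xS : x \in S) (yS : y \notin S) (dy : m d y = y).
Hypothesis inj_x : forall c c', m c x != x -> m c x = m c' x -> c = c'.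
Hypothesis nbr_x : forall c, m c x != x -> m c x \notin S /\ m c x != y.
Hypothesis L_S : forall v w, w \in L v ->
  [/\ w \in S, w != x, G v w & #|K| <= e * #|missing m w|].
Hypothesis missx : #|K| <= e * #|missing m x|.

(** An edge may have several colours, so one is picked. The default is never reached for [v != x]
    and [w \in L v], as only [xy] is uncoloured. *)
Definition edge_color v w : K := odflt d [pick c | m c v == w].

Lemma edge_colorP v w : v != x -> w \in L v -> m (edge_color v w) v = w.
Proof.
move=> vx wL; have [wS wx Gvw _] := L_S wL; rewrite /edge_color.
case: pickP => [c /eqP //|no]; have := cm.2 _ _ Gvw.
rewrite !inE !xpair_eqE (negbTE vx) (negbTE wx) /= => /existsP[c].
by rewrite no.
Qed.

Let xy : x != y. Proof. by apply: contraNneq yS => <-. Qed.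
Let yx : y != x. Proof. by rewrite eq_sym. Qed.

(* The other end of the edge at [x] with the colour of [yz]. *)
Definition opposite z : T := m (edge_color y z) x.

Let neS v w : v \notin S -> w \in S -> (v != w) /\ (w != v).
Proof. by move=> h k; split; apply: contraNneq h => E; rewrite ?E // -E. Qed.

(** Among [4 * e] such vertices, [share_common] makes one share a missing colour with [x] while the
    edges at [y] towards them keep their colours; this contradicts [fan_disjoint]. *)
Lemma few_missing_at_x : 2 * e * (4 * e + 1) < #|K| ->
  #|[set z in L y | m (edge_color y z) x == x]| < 4 * e.
Proof.
move=> small; rewrite ltnNge; apply/negP => /exists_subset_card[Y sY cY].
have YL z : z \in Y -> z \in L y /\ m (edge_color y z) x = x.
  by move/(subsetP sY); rewrite inE => /andP[? /eqP].
have [|||||m' [z [_ [a [[c1 o1 x1 _] [zY _ _] anP [ax az _]]]]]] :=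
  share_common (x := x) (e := e) (Y := Y) (P := d |: edge_color y @: Y) cm.
- by apply/negP => /YL[/L_S[_ ]]; rewrite eqxx.
- by move=> z /YL[/L_S[]].
- by [].
- by rewrite cY.
- apply: leq_ltn_trans small; rewrite leq_mul2l; apply/orP; right.
  have := (leq_card_setU [set d] (edge_color y @: Y)).1; rewrite cards1.
  have : #|edge_color y @: Y| <= #|Y| := leq_imset_card _ _; lia.
have [zL zx] := YL _ zY; have [zS _ _ _] := L_S zL.
have PY : edge_color y z \in d |: edge_color y @: Y by rewrite inE imset_f ?orbT.
apply: (fan_disjoint G_irr no_coloring c1 (z := z) (al := edge_color y z) (et := a)
  (d := d)) => //.
- by have [] := neS yS zS.
- by rewrite x1.
- by rewrite o1 // edge_colorP.
- by rewrite o1 ?setU11.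
Qed.

Definition via_missing z : {set T} :=
  [set w in L (opposite z) | m (edge_color (opposite z) w) x == x].

(** One use of [share_common] selects [z], a second one selects [w] in [via_missing z], and
    [fan_disjoint_next] applies. As [z] is known only after the first use, [P] protects the edges of
    all candidates. *)
Lemma few_via_missing : 2 * e * (4 * e * (4 * e) + 4 * e + 2) < #|K| ->
  #|[set z in L y | (opposite z != x) && (4 * e <= #|via_missing z|)]| < 4 * e.
Proof.
move=> small; rewrite ltnNge; apply/negP => /exists_subset_card[Y sY cY].
have YL z : z \in Y -> [/\ z \in L y, opposite z != x & 4 * e <= #|via_missing z|].
  by move/(subsetP sY); rewrite inE => /and3P[].
(* Truncation to [4 * e] elements keeps [P] bounded. *)
pose W z : {set T} := [set w in take (4 * e) (enum (via_missing z))].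
have cW z : #|W z| <= 4 * e.
  rewrite cardsE; apply: leq_trans (card_size _) _; by rewrite size_take; case: ltnP.
have cW' z : z \in Y -> #|W z| = 4 * e.
  case/YL=> _ _ h; rewrite cardsE (card_uniqP _) ?take_uniq ?enum_uniq // size_take -cardE.
  by case: ltngtP h.
have WL z w : w \in W z -> w \in L (opposite z) /\ m (edge_color (opposite z) w) x = x.
  by rewrite inE => /mem_take; rewrite mem_enum inE => /andP[? /eqP].
pose P := (d |: edge_color y @: Y)
  :|: \bigcup_(z in Y) [set edge_color (opposite z) w | w in W z].
have cP : #|P| <= 4 * e * (4 * e) + 4 * e + 1.
  have := (leq_card_setU (d |: edge_color y @: Y)
     (\bigcup_(z in Y) [set edge_color (opposite z) w | w in W z])).1.
  have := (leq_card_setU [set d] (edge_color y @: Y)).1; rewrite cards1.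
  have : #|edge_color y @: Y| <= #|Y| := leq_imset_card _ _.
  have : #|\bigcup_(z in Y) [set edge_color (opposite z) w | w in W z]| <= #|Y| * (4 * e).
    apply: leq_trans (card_bigcup_le _ _) _; rewrite -sum_nat_const; apply: leq_sum => z _.
    by apply: leq_trans (cW z); apply: leq_imset_card.
  rewrite cY -/P; lia.
have [|||||m1 [z [_ [a [r1 [zY _ _] anP [ax az _]]]]]] :=
  share_common (x := x) (e := e) (Y := Y) (P := P) cm.
- by apply/negP => /YL[/L_S[_ ]]; rewrite eqxx.
- by move=> z /YL[/L_S[]].
- by [].
- by rewrite cY.
- apply: leq_ltn_trans small; rewrite leq_mul2l; apply/orP; right; lia.
have [c1 o1 x1 k1] := r1.
have [zL ux _] := YL _ zY; have [zS zx _ _] := L_S zL.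
have [|||||m2 [w [_ [et [[c2 o2 x2 _] [wW _ _] enP [ex ew _]]]]]] :=
  share_common (x := x) (e := e) (Y := W z) (P := a |: P) c1.
- by apply/negP => /WL[/L_S[_ ]]; rewrite eqxx.
- by move=> w /WL[/L_S[_ _ _]]; rewrite k1.
- by rewrite k1.
- by rewrite cW'.
- apply: leq_ltn_trans small; rewrite leq_mul2l; apply/orP; right.
  by rewrite cardsU1 anP; move: cP; clear; move: (4 * e * _) => q; lia.
have [wL wx] := WL _ _ wW; have [wS _ _ _] := L_S wL.
have [uS uy] := nbr_x ux.
have dP : d \in P by rewrite !inE eqxx.
have bP : edge_color y z \in P by rewrite !inE imset_f ?orbT.
have gP : edge_color (opposite z) w \in P.
  by rewrite inE; apply/orP; right; apply/bigcupP; exists z => //; apply: imset_f.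
have O c v : c \in P -> m2 c v = m c v by move=> cP'; rewrite o2 ?o1 // inE cP' orbT.
apply: (fan_disjoint_next G_irr no_coloring c2 xy (u := opposite z) (z := z) (w := w)
   (d := d) (a := a) (b := edge_color y z) (al := edge_color (opposite z) w) (et := et)) => //.
- by have [] := neS yS zS.
- by have [] := neS uS wS.
- by rewrite O.
- by rewrite O // edge_colorP.
- by rewrite O.
- by rewrite x2.
- by rewrite o2 // setU11.
- by rewrite O.
- by rewrite O // edge_colorP.
- by apply: contraNneq anP => ->.
- by apply: contraNneq enP => <-; rewrite setU11.
Qed.


Lemma no_crowded_coloring g k1 M :
  #|[set c | (m c x != x) && (#|L (m c x)| < k1)]| <= g ->
  g + 2 * (4 * e) + M <= #|L y| ->
  (14 * (4 * e) + 1) * #|[set c | m c x != x]| < M * (k1 - 4 * e) ->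
  2 * e * (4 * e * (4 * e) + 4 * e + 16 * M + 10) < #|K| -> False.
Proof.
move=> cg cL big small; set N := 4 * e in cL big small.
pose be := edge_color y; pose u := opposite.
have small1 : 2 * e * (4 * e + 1) < #|K|.
  by apply: leq_ltn_trans small; rewrite leq_mul2l; apply/orP; right; rewrite /N; lia.
have small2 : 2 * e * (4 * e * (4 * e) + 4 * e + 2) < #|K|.
  by apply: leq_ltn_trans small; rewrite leq_mul2l; apply/orP; right; rewrite /N; lia.
have few1 := few_missing_at_x small1; have few2 := few_via_missing small2.
have beP z : z \in L y -> m (be z) y = z by exact: edge_colorP.
have be_inj z z' : z \in L y -> z' \in L y -> be z = be z' -> z = z'.
  by move=> /beP {2}<- /beP {2}<- ->.
(* At most [g] vertices fail the last condition, since [be] is injective, and fewer than [4 * e]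
   fail each of the other two. *)
pose Zg := [set z in L y | [&& u z != x, #|via_missing z| < N & k1 <= #|L (u z)|]].
have cZg : M <= #|Zg|.
  pose Y3 := [set z in L y | (u z != x) && (#|L (u z)| < k1)].
  have c3 : #|Y3| <= g.
    have <- : #|be @: Y3| = #|Y3|.
      apply: card_in_imset => z z'; rewrite !inE => /andP[h _] /andP[h' _].
      exact: be_inj.
    apply: leq_trans cg; apply: subset_leq_card; apply/subsetP => c /imsetP[z].
    by rewrite !inE => /andP[_ h] ->.
  have : #|L y| <= #|[set z in L y | m (edge_color y z) x == x] :|:
     [set z in L y | (opposite z != x) && (4 * e <= #|via_missing z|)] :|: Y3 :|: Zg|.
    apply: subset_leq_card; apply/subsetP => z zL; rewrite !inE zL /= -/(opposite z) -/(u z).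
    by case: eqP => //= _; rewrite -/N; case: (leqP N); case: (ltnP #|L (u z)| k1).
  move: few1 few2 c3; move: [set z in L y | _] => A1; move: [set z in L y | _] => A2.
  have := (leq_card_setU (A1 :|: A2 :|: Y3) Zg).1.
  have := (leq_card_setU (A1 :|: A2) Y3).1.
  have := (leq_card_setU A1 A2).1.
  rewrite -/N; lia.
have [Zs sZs cZs] := exists_subset_card cZg.
have ZsP z : z \in Zs -> [/\ z \in L y, u z != x, #|via_missing z| < N & k1 <= #|L (u z)|].
  by move/(subsetP sZs); rewrite inE => /and4P[].
pose C := [set c | m c x != x].
pose F z := [set c | [&& m c x != x, c != d & m c (u z) \in L (u z)]].
(* Fewer than [N] elements of [L (u z)] are reached by colours missing at [x] and at most one by
   [d], whence [k1 - N]. The bound [14 * N + 1] lets two vertices survive the losses to [B]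
   below. *)
have [|||ga gaC cga] := @popular_color _ _ Zs C F (k1 - N) (14 * N + 1).
- by move=> z _; apply/subsetP => c; rewrite !inE => /andP[].
- move=> z /ZsP[_ ux hV hL]; rewrite leq_subLR.
  apply: leq_trans hL _.
  apply: (@leq_trans #|via_missing z :|: (fun c => m c (u z)) @: (d |: F z)|).
    apply: subset_leq_card; apply/subsetP => w wL; rewrite !inE wL /=.
    case: eqP => // /eqP h; apply/imsetP; exists (edge_color (u z) w); last first.
      by rewrite edge_colorP.
    by rewrite !inE h edge_colorP // wL; case: eqP.
  have := (leq_card_setU (via_missing z) ((fun c => m c (u z)) @: (d |: F z))).1.
  have : #|(fun c => m c (u z)) @: (d |: F z)| <= #|d |: F z| := leq_imset_card _ _.
  have := (leq_card_setU [set d] (F z)).1; rewrite cards1; lia.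
- by rewrite cZs.
pose Zga := [set z in Zs | ga \in F z]; pose w z := m ga (u z).
have ZgaP z : z \in Zga -> [/\ z \in Zs, ga != d & w z \in L (u z)].
  by rewrite !inE => /andP[zs /and3P[]].
have w_inj : {in Zga &, injective w}.
  move=> z z' /ZgaP[/ZsP[zL ux _ _] _ _] /ZgaP[/ZsP[z'L _ _ _] _ _].
  by move=> E; apply: be_inj => //; apply: (inj_x ux); apply: (can_inj (cm.1 ga)).
pose P := d |: (ga |: be @: Zs); pose Y := Zs :|: w @: Zga.
have cP : #|P| <= M + 2.
  have := (leq_card_setU [set d] (ga |: be @: Zs)).1.
  have := (leq_card_setU [set ga] (be @: Zs)).1.
  have : #|be @: Zs| <= #|Zs| := leq_imset_card _ _.
  rewrite cZs !cards1 -/P; lia.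
have cZga : #|Zga| <= M by rewrite -cZs subset_leq_card //; apply/subsetP => z /ZgaP[].
have cY : #|Y| <= 2 * M.
  have := (leq_card_setU Zs (w @: Zga)).1.
  have : #|w @: Zga| <= #|Zga| := leq_imset_card _ _.
  rewrite cZs -/Y; lia.
have YP v : v \in Y -> [/\ v \in S, v != x & #|K| <= e * #|missing m v|].
  rewrite inE => /orP[/ZsP[/L_S[] //]|/imsetP[z /ZgaP[_ _ /L_S[? ? _ ?]] ->]].
  by split.
have ZsY z : z \in Zs -> z \in Y by move=> h; rewrite inE h.
(* Seven rounds: [a1] to [a6] use one each, and the last serves both [z3] and [z4]. The colours
   counted are at most [M + 2 + 7 * (2 * M)]. *)
have [||||m1 [f [B [r1 cB fP fI]]]] :=
  share_many (x := x) (e := e) (r := 7) (P := P) (Y := Y) cm.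
- by apply/negP => /YP[_ ]; rewrite eqxx.
- by move=> z /YP[].
- by [].
- by apply: leq_ltn_trans small; rewrite leq_mul2l; apply/orP; right; lia.
have [c1 o1 x1 k1'] := r1.
(* [B] has at most [7 * N] elements and excludes [z] either directly or through [w z]; [w] is
   injective, so at most [14 * N] vertices are lost. *)
have : 1 < #|Zga :\: B :\: [set z in Zga | w z \in B]|.
  have h1 : #|[set z in Zga | w z \in B]| <= #|B|.
    rewrite -(card_in_imset (f := w)); last first.
      by move=> z z'; rewrite !inE => /andP[h _] /andP[h' _]; apply: w_inj; rewrite !inE.
    by apply: subset_leq_card; apply/subsetP => v /imsetP[z]; rewrite !inE => /andP[_ h] ->.
  have := cardsID B Zga; have := subset_leq_card (subsetIr Zga B).
  have := cardsID [set z in Zga | w z \in B] (Zga :\: B).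
  have := subset_leq_card (subsetIr (Zga :\: B) [set z in Zga | w z \in B]).
  move: h1 cga cB; rewrite -/N -/Zga; clear; move: N => N; lia.
have ZgaY z : z \in Zga :\: B :\: [set z in Zga | w z \in B] ->
    [/\ z \in Zga, z \in Y :\: B & w z \in Y :\: B].
  case/setDP=> /setDP[zg zB] h; have [zs _ _] := ZgaP _ zg.
  split=> //; first by rewrite in_setD zB ZsY.
  rewrite in_setD in_setU imset_f // orbT andbT.
  by apply: contra h => h; rewrite in_set zg.
case/card_gt1P=> z1 [z2 [/ZgaY[zg1 zY1 wY1] /ZgaY[zg2 zY2 wY2] z12]] {ZgaY}.
(* Excluding [m ga y] ensures that [be z] differs from [ga]. *)
pose Z' := Zs :\: (B :|: [set z in [:: z1; z2; w z1; w z2; m ga y]]).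
have cZ' : 4 * e <= #|Z'|.
  have := cardsID (B :|: [set z in [:: z1; z2; w z1; w z2; m ga y]]) Zs.
  have := subset_leq_card (subsetIr Zs (B :|: [set z in [:: z1; z2; w z1; w z2; m ga y]])).
  have := (leq_card_setU B [set z in [:: z1; z2; w z1; w z2; m ga y]]).1.
  have : #|[set z in [:: z1; z2; w z1; w z2; m ga y]]| <= 5.
    by rewrite cardsE; apply: card_size.
  move: cga cB cZga; rewrite -/N -/Zga cZs -/Z'; clear; move: N => N; lia.
pose a1 := f 0 z1; pose a2 := f 1 z2; pose a3 := f 2 (w z1); pose a4 := f 3 (w z2).
pose a5 := f 4 (w z2); pose a6 := f 5 (w z1).
pose P' := P :|: [set c in [:: a1; a2; a3; a4; a5; a6]] :|: f 6 @: Z'.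
have Z'Y z : z \in Z' -> z \in Zs /\ z \in Y :\: B.
  by case/setDP=> zs; rewrite in_setD in_setU negb_or => /andP[-> _]; rewrite ZsY.
have [|||||m2 [z3 [z4 [a [[c2 o2 x2 _] [z3Z z4Z z34] anP [ax az3 az4]]]]]] :=
  share_common (x := x) (e := e) (Y := Z') (P := P') c1.
- by apply/negP => /Z'Y[/ZsY/YP[_ ]]; rewrite eqxx.
- by move=> z /Z'Y[/ZsY/YP[]]; rewrite k1'.
- by rewrite k1'.
- by [].
- apply: leq_ltn_trans small; rewrite leq_mul2l; apply/orP; right.
  have := (leq_card_setU (P :|: [set c in [:: a1; a2; a3; a4; a5; a6]]) (f 6 @: Z')).1.
  have := (leq_card_setU P [set c in [:: a1; a2; a3; a4; a5; a6]]).1.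
  have : #|[set c in [:: a1; a2; a3; a4; a5; a6]]| <= 6 by rewrite cardsE; apply: card_size.
  have : #|f 6 @: Z'| <= #|Z'| := leq_imset_card _ _.
  have := subset_leq_card (subsetDl Zs (B :|: [set z in [:: z1; z2; w z1; w z2; m ga y]])).
  move: cP; rewrite -/Z' -/P' cZs; clear; move: (4 * e * _) (4 * e) => q q'; lia.
have sPP c : c \in P -> c \in P' by move=> h; do 2 (apply/setUP; left).
have OP c v : c \in P -> m2 c v = m c v by move=> h; rewrite o2 ?o1 ?sPP.
have Of i z : i < 7 -> z \in Y :\: B -> f i z \in P' ->
    m2 (f i z) x = x /\ m2 (f i z) z = z.
  by move=> i7 zY h; have [_ fx fz] := fP i z i7 zY; rewrite x2 o2.
have A1 : a1 \in P' by rewrite !inE eqxx !orbT.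
have A2 : a2 \in P' by rewrite !inE eqxx !orbT.
have A3 : a3 \in P' by rewrite !inE eqxx !orbT.
have A4 : a4 \in P' by rewrite !inE eqxx !orbT.
have A5 : a5 \in P' by rewrite !inE eqxx !orbT.
have A6 : a6 \in P' by rewrite !inE eqxx !orbT.
have A7 z : z \in Z' -> f 6 z \in P' by move=> h; apply/setUP; right; apply: imset_f.
have dP : d \in P by rewrite !inE eqxx.
have gP : ga \in P by rewrite !inE eqxx orbT.
have bP z : z \in Zs -> be z \in P by move=> h; rewrite !in_setU imset_f ?orbT.
have [zs1 gad wL1] := ZgaP _ zg1; have [zs2 _ wL2] := ZgaP _ zg2.
have [zs3 zY3] := Z'Y _ z3Z; have [zs4 zY4] := Z'Y _ z4Z.
have nP i z : i < 7 -> z \in Y :\: B -> f i z \notin P by move=> h h'; have [] := fP i z h h'.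
have neP p q : p \in P -> q \notin P -> p != q by move=> h; apply: contraNneq => <-.
have neP' p q : p \in P' -> q \notin P' -> q != p by move=> h; apply: contraNneq => ->.
have bne z z' : z \in Zs -> z' \in Zs -> z != z' -> be z != be z'.
  by move=> /ZsP[h _ _ _] /ZsP[h' _ _ _]; apply: contraNneq => E; apply/eqP; apply: be_inj.
have dbe z : z \in Zs -> d != be z.
  move=> /ZsP[h _ _ _]; have [zS _ _ _] := L_S h; have [_] := neS yS zS.
  by apply: contraNneq => E; rewrite -(beP z h) -E dy.
have ubx z : m (be z) x = u z by [].
(* If [yz] had colour [ga], then so would the edge from [x] to [u z], and [w z] would be [x]. *)
have bga z : z \in Zga -> be z != ga.
  move=> /ZgaP[zs _ wL]; have [_ wx _ _] := L_S wL.
  by apply: contraNneq wx => E; rewrite /w -E -ubx (cm.1 (be z)).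
have Z'ne z : z \in Z' -> [/\ z != z1, z != z2, z != w z1, z != w z2 & be z != ga].
  move=> h; have [/ZsP[zL _ _ _] _] := Z'Y _ h.
  case/setDP: h => _; rewrite in_setU negb_or => /andP[_].
  rewrite !inE !negb_or => /and5P[-> -> -> -> h]; split=> //.
  by apply: contraNneq h => <-; rewrite beP.
have colors z : z \in Z' -> uniq [:: d; be z1; be z2; be z; ga; a; a1; a2; a3; a4; a5; a6; f 6 z].
  move=> zZ; have [n1 n2 _ _ n5] := Z'ne _ zZ; have [zs zY] := Z'Y _ zZ.
  rewrite /= !inE !negb_or -!andbA.
  do ! (apply/andP; split) => //;
    first [ exact: dbe | by apply: bne => //; rewrite eq_sym | exact: bga | by rewrite eq_sym
          | by apply: neP => //; [apply: bP | apply: nP]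
          | by apply: neP => //; apply: nP
          | by rewrite eq_sym; apply: neP'; [apply: sPP; apply: bP |]
          | by rewrite eq_sym; apply: neP'; [apply: sPP |]
          | by apply: neP'; [apply: A7|]
          | exact: neP'
          | exact: fI ].
have [zL1 ux1 _ _] := ZsP _ zs1; have [zL2 ux2 _ _] := ZsP _ zs2.
have [zL3 _ _ _] := ZsP _ zs3; have [zL4 _ _ _] := ZsP _ zs4.
have [z1S z1x _ _] := L_S zL1; have [z2S z2x _ _] := L_S zL2.
have [z3S z3x _ _] := L_S zL3; have [z4S z4x _ _] := L_S zL4.
have [w1S w1x _ _] := L_S wL1; have [w2S w2x _ _] := L_S wL2.
have [u1S u1y] := nbr_x ux1; have [u2S u2y] := nbr_x ux2.
have w12 : w z1 != w z2 by apply: contraNneq z12 => E; apply/eqP; apply: w_inj.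
have u12 : u z1 != u z2 by apply: contraNneq w12 => E; rewrite /w E.
have [_ _ n31 _ _] := Z'ne _ z3Z; have [_ _ n41 _ _] := Z'ne _ z4Z.
apply: (siblings G_irr no_coloring (S := S) c2 _ _ _ _ (colors _ z3Z) (colors _ z4Z)
  (u1 := u z1) (u2 := u z2) (z1 := z1) (z2 := z2) (z3 := z3) (z4 := z4)
  (w1 := w z1) (w2 := w z2)).
- by split=> //; apply/and3P; split=> //; rewrite eq_sym.
- by rewrite z1S z2S z3S z4S w1S w2S.
- by [].
- by rewrite z34 n31 n41.
- by rewrite !OP ?bP ?dy ?beP.
- by rewrite !x2 !x1 !OP.
- exact: Of.
- exact: Of.
- exact: Of.
- exact: Of.
- exact: Of.
- exact: Of.
- by apply: Of => //; apply: A7.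
- by apply: Of => //; apply: A7.
- by [].
Qed.

End Counting.

(** * Edge colourings as families of matchings *)

Section EdgeColorings.
Variable T : finType.
Implicit Types (G : sgraph T) (k : nat).

Lemma edgesP G e : reflect (exists u v, G u v /\ e = [set u; v]) (e \in edges G).
Proof.
apply: (iffP imset2P) => [[u v _ + ->]|[u [v [uv ->]]]].
  by rewrite inE => uv; exists u, v.
by exists u v; rewrite ?inE.
Qed.

Lemma set2_injr (u v w : T) : [set u; v] = [set u; w] -> v = w.
Proof.
move=> E; have : v \in [set u; w] by rewrite -E set22.
have : w \in [set u; v] by rewrite E set22.
by rewrite !inE => /orP[]/eqP-> // /orP[]/eqP->.
Qed.

Lemma edge_set2 G u v : [set u; v] \in edges G -> G u v.
Proof.
case/edgesP=> a [b [ab E]]; have := set21 a b; rewrite -E !inE => /orP[]/eqP aE.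
  by rewrite aE in ab E; rewrite (set2_injr E).
by rewrite aE setUC in E; rewrite (set2_injr E) adj_sym -aE.
Qed.

Lemma edge_colorable_matchings G k : edge_colorable G k ->
  exists m : 'I_k -> T -> T, [/\ coloring_but G [::] m,
    forall c v, m c v != v -> G v (m c v) &
    forall c c' v, m c v != v -> m c v = m c' v -> c = c'].
Proof.
case/existsP=> c /forallP pc.
pose has_color i u v := [exists f : {g : {set T} | g \in edges G}, (val f == [set u; v]) && (c f == i)].
have uniqf (f f' : {g : {set T} | g \in edges G}) v : v \in val f -> v \in val f' -> c f = c f' -> f = f'.
  move=> vf vf' cE; apply/eqP; move/forallP/(_ f'): (pc f); rewrite cE eqxx.
  have -> : val f :&: val f' != set0 by apply/set0Pn; exists v; rewrite inE vf.
  by rewrite andbT; case: eqP.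
have hE i u v w : has_color i u v -> has_color i u w -> v = w.
  case/existsP=> f /andP[/eqP fE /eqP fi] /existsP[f' /andP[/eqP f'E /eqP f'i]].
  apply: (@set2_injr u); rewrite -fE -f'E; congr val.
  by apply: (uniqf _ _ u); rewrite ?fE ?f'E ?set21 // fi f'i.
have hsym i u v : has_color i u v = has_color i v u by rewrite /has_color setUC.
have hG i u v : has_color i u v -> G u v.
  by case/existsP=> f /andP[/eqP fE _]; apply: edge_set2; rewrite -fE; exact: valP.
pose m i u := odflt u [pick v | has_color i u v].
have mP i u v : has_color i u v -> m i u = v.
  by rewrite /m => h; case: pickP => [w /= h'|/(_ v)]; [exact: hE h' h | rewrite h].
have mP' i u : m i u != u -> has_color i u (m i u).
  by rewrite /m; case: pickP => //= _; rewrite eqxx.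
exists m; split.
- split=> [i u|u v uv].
    have [E|h] := eqVneq (m i u) u; first by rewrite !E.
    by apply: mP; rewrite hsym; apply: mP'.
  have uvE : [set u; v] \in edges G by apply/edgesP; exists u, v.
  rewrite !in_nil /=; apply/existsP; exists (c (exist (fun f => f \in edges G) _ uvE)); apply/eqP/mP.
  by apply/existsP; exists (exist (fun f => f \in edges G) _ uvE); rewrite /= !eqxx.
- by move=> i v /mP'/hG.
- move=> i j v h E; have h' : m j v != v by rewrite -E.
  have /existsP[f /andP[/eqP fE /eqP fi]] := mP' i v h.
  have /existsP[f' /andP[/eqP f'E /eqP f'j]] := mP' j v h'.
  by rewrite -fi -f'j; congr (c _); apply: val_inj; rewrite fE f'E E.
Qed.

(** Every edge chooses a class containing it; two edges at [v] in class [i] are both the pair of [v]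
    and [m i v]. *)
Lemma matchings_edge_colorable G k (m : 'I_k -> T -> T) :
  coloring_but G [::] m -> edge_colorable G k.
Proof.
move=> [mK cov].
have ex (f : {f : {set T} | f \in edges G}) :
    exists i, [exists u, val f == [set u; m i u]].
  have /edgesP[u [v [uv fE]]] := valP f.
  have := cov _ _ uv; rewrite !in_nil => /existsP[i /eqP iE].
  by exists i; apply/existsP; exists u; rewrite iE fE.
apply/existsP; exists [ffun f => xchoose (ex f)].
apply/forallP=> f; apply/forallP=> f'; apply/implyP=> /andP[ff' /set0Pn[v]].
rewrite !ffunE inE; have /existsP[u /eqP fE] := xchooseP (ex f).
have /existsP[u' /eqP f'E] := xchooseP (ex f').
move=> /andP[vf vf']; apply: contraNneq ff' => E; apply/eqP/val_inj.
move: fE f'E; rewrite {}E; move: (xchoose _) => i.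
have vE w (g : {set T}) : v \in g -> g = [set w; m i w] -> g = [set v; m i v].
  move=> vg gE; move: vg; rewrite gE !inE => /orP[]/eqP-> //.
  by rewrite mK setUC.
by move=> /(vE _ _ vf)-> /(vE _ _ vf')->.
Qed.

Lemma chromatic_index_colorable G : edge_colorable G (chromatic_index G).
Proof. by rewrite /chromatic_index; case: ex_minnP. Qed.

Lemma critical_no_coloring G (m : 'I_(max_degree G) -> T -> T) :
  critical G -> ~ coloring_but G [::] m.
Proof.
case=> _ chi _ /matchings_edge_colorable; move: chi; rewrite /chromatic_index.
by case: ex_minnP => k _ min kE /min; rewrite kE ltnn.
Qed.

Lemma critical_coloring G x y : critical G -> G x y ->
  exists m : 'I_(max_degree G) -> T -> T, [/\ coloring_but G [:: (x, y)] m,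
    forall c v, m c v != v -> G v (m c v),
    forall c, m c x != y &
    forall c c' v, m c v != v -> m c v = m c' v -> c = c'].
Proof.
move=> [_ _ crit] xy; have xyE : [set x; y] \in edges G by apply/edgesP; exists x, y.
have := chromatic_index_colorable (del_edge G [set x; y]); rewrite crit //.
case/edge_colorable_matchings=> m [[mK cov] adjm injm]; exists m; split.
- split=> // u v uv; have [E|n] := eqVneq [set u; v] [set x; y]; last first.
    have /cov : del_edge G [set x; y] u v by rewrite /= /del_edge_rel /= uv n.
    by rewrite !in_nil /= => ->; rewrite !orbT.
  rewrite !inE !xpair_eqE; have := set21 u v; rewrite E !inE => /orP[]/eqP uE.
    by rewrite uE in E; rewrite uE (set2_injr E) !eqxx.
  by rewrite uE [RHS]setUC in E; rewrite uE (set2_injr E) !eqxx ?orbT.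
- by move=> c v /adjm/andP[].
- move=> c; apply/eqP=> E; have nx : y != x by apply: contraTneq xy => ->; rewrite adj_irr.
  by have := adjm c x; rewrite E => /(_ nx) /andP[_]; rewrite eqxx.
- exact: injm.
Qed.

Lemma card_missing_ge G k (m : 'I_k -> T -> T) v :
  (forall c, m c v != v -> G v (m c v)) ->
  (forall c c', m c v != v -> m c v = m c' v -> c = c') ->
  k <= #|missing m v| + degree G v.
Proof.
move=> adjm injm; rewrite -{1}(card_ord k) -(cardsC (missing m v)) leq_add2l /degree.
rewrite -(card_in_imset (f := m^~ v)); last first.
  by move=> c c'; rewrite !inE => h _; apply: injm.
by apply: subset_leq_card; apply/subsetP=> w /imsetP[c]; rewrite !inE => /adjm h ->.
Qed.

Lemma degree_le_max G v : degree G v <= max_degree G.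
Proof. exact: leq_bigmax. Qed.

Lemma min_degree_le G v : min_degree G <= degree G v.
Proof.
rewrite /min_degree; have : v \in index_enum T by rewrite mem_index_enum.
elim: (index_enum T) => // u r IH; rewrite inE big_cons => /orP[/eqP->|/IH h].
  exact: geq_minl.
by rewrite geq_min h orbT.
Qed.

End EdgeColorings.

(** * Discharging *)

Import Order.TTheory GRing.Theory Num.Theory.

(** Markov's inequality: each [y] with [k y < t] contributes at least [1 / t] to the sum. *)
Lemma card_small_lt (T : finType) (A : {set T}) (k : T -> nat) (E t : nat) :
  (forall y, y \in A -> 0 < k y) -> 0 < t ->
  (\sum_(y in A) (k y)%:R^-1 < E%:R :> rat)%R ->
  #|[set y in A | k y < t]| < E * t.
Proof.
move=> k0 t0 sumE; rewrite -(ltr_nat rat) natrM -ltr_pdivrMr ?ltr0n //.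
apply: le_lt_trans sumE; rewrite -sum1_card natr_sum mulr_suml.
rewrite [leRHS](bigID (fun y => k y < t)) /= -[leLHS]addr0 lerD //; last first.
  by apply: sumr_ge0 => y _; rewrite invr_ge0 ler0n.
rewrite (eq_bigl (fun y => (y \in A) && (k y < t))); last by move=> y; rewrite inE.
apply: ler_sum => y /andP[/k0 ky kt].
by rewrite div1r lef_pV2 ?posrE ?ltr0n // ler_nat ltnW.
Qed.

Section Discharging.
Variables (T : finType) (G : sgraph T) (S : {set T}) (e : nat).
Hypothesis crit : critical G.
Hypothesis indS : independent G S.

Definition low : {set T} := [set v in S | max_degree G <= e * (max_degree G - degree G v)].
Definition low_nbrs v : {set T} := [set w in low | G v w].

Lemma independentP v w : v \in S -> w \in S -> ~~ G v w.
Proof. by move=> vS wS; move/forall_inP/(_ v vS)/forall_inP/(_ w wS): indS. Qed.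

Lemma no_crowded_neighborhood x y g k1 M : x \in low -> G x y ->
  #|[set u | G x u && (#|low_nbrs u :\ x| < k1)]| <= g ->
  g + 2 * (4 * e) + M <= #|low_nbrs y :\ x| ->
  (14 * (4 * e) + 1) * degree G x < M * (k1 - 4 * e) ->
  2 * e * (4 * e * (4 * e) + 4 * e + 16 * M + 10) < max_degree G -> False.
Proof.
rewrite inE => /andP[xS xlow] xy cg cL small big.
have [m [cm adjm nxy injm]] := critical_coloring crit xy.
have missE v : max_degree G - degree G v <= #|missing m v|.
  by rewrite leq_subLR addnC; exact: (card_missing_ge (fun c => adjm c v) (fun c c' => injm c c' v)).
have missL v : max_degree G <= e * (max_degree G - degree G v) ->
    #|'I_(max_degree G)| <= e * #|missing m v|.
  by rewrite card_ord => h; apply: leq_trans h _; rewrite leq_mul2l missE orbT.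
(* [y] has degree at most the number of colours, and its edge to [x] is uncoloured. *)
have [d dy] : exists d, m d y = y.
  case: (pickP (fun d => m d y == y)) => [d /eqP|no]; first by exists d.
  have /negP[] : ~~ (max_degree G < degree G y) by rewrite -leqNgt degree_le_max.
  rewrite /degree (cardsD1 x) inE [G y x]adj_sym xy ltnS.
  rewrite -[X in X <= _](card_ord (max_degree G)) -cardsT -(card_in_imset (f := m^~ y)); last first.
    by move=> c c' _ _; apply: injm; rewrite no.
  apply: subset_leq_card; apply/subsetP=> w /imsetP[c _ ->].
  rewrite !inE adjm ?no // andbT; apply: contra (nxy c) => /eqP <-.
  by case: cm => mK _; rewrite mK.
have nbrx c : m c x != x -> m c x \notin S /\ m c x != y.
  move=> h; split; last exact: nxy.
  by apply: contraTN (adjm _ _ h) => h'; apply: independentP.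
apply: (@no_crowded_coloring _ _ G S (fun v => low_nbrs v :\ x) x y d m e _ _ _ _ _ _ _ _ _ _ g k1 M) => //.
- exact: adj_irr.
- by move=> m'; apply: critical_no_coloring.
- by apply: contraL xy => yS; apply: independentP.
- by move=> c c'; apply: injm.
- move=> v w; rewrite !inE => /and3P[wx /andP[wS wlow] vw].
  by split=> //; apply: missL.
- exact: missL.
- apply: leq_trans cg; rewrite -(card_in_imset (f := m^~ x)); last first.
    by move=> c c'; rewrite !inE => /andP[h _] _; apply: injm.
  apply: subset_leq_card; apply/subsetP=> w /imsetP[c]; rewrite !inE => /andP[h1 h2] ->.
  by rewrite adjm.
- apply: leq_ltn_trans small; rewrite leq_mul2l; apply/orP; right.
  rewrite /degree -(card_in_imset (f := m^~ x)); last first.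
    by move=> c c'; rewrite !inE => h _; apply: injm.
  apply: subset_leq_card; apply/subsetP=> w /imsetP[c]; rewrite !inE => h ->.
  exact: adjm.
- by rewrite card_ord.
Qed.

Lemma low_nbrs_gt0 x y : x \in low -> G x y -> 0 < #|low_nbrs y|.
Proof. by move=> xl xy; apply/card_gt0P; exists x; rewrite inE xl adj_sym. Qed.

(* If the sum is less than [E], then for every [t] fewer than [E * t] neighbours of
   [x] have fewer than [t] low neighbours; this is used for [t := deg x / (2 E^2)]
   and for [2 * E * t]. *)
Lemma sum_inv_low_nbrs (E : nat) x : 0 < E -> x \in low ->
  let M := 4 * E ^ 2 * (14 * (4 * e) + 1) in
  2 * E ^ 2 * (2 * (4 * e) + M + 3) <= degree G x ->
  2 * e * (4 * e * (4 * e) + 4 * e + 16 * M + 10) < max_degree G ->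
  (E%:R <= \sum_(y in [set y | G x y]) #|low_nbrs y|%:R^-1 :> rat)%R.
Proof.
move=> E0 xl M deg big; rewrite leNgt; apply/negP => sumE.
have pos y : y \in [set y | G x y] -> 0 < #|low_nbrs y|.
  by rewrite inE; apply: low_nbrs_gt0.
pose t := degree G x %/ (2 * E ^ 2).
have EE : 0 < 2 * E ^ 2 by rewrite muln_gt0 expn_gt0 E0.
have t_ge : 2 * (4 * e) + M + 3 <= t by rewrite /t leq_divRL // mulnC.
have t_le : t * (2 * E ^ 2) <= degree G x by rewrite leq_trunc_div.
have t_gt : degree G x < t.+1 * (2 * E ^ 2) by rewrite ltn_ceil.
have t0 : 0 < t by lia.
have lt1 := card_small_lt pos t0 sumE.
have Et0 : 0 < 2 * E * t by rewrite !muln_gt0 E0.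
have lt2 := card_small_lt pos Et0 sumE.
(* Fewer than [E * (2 * E * t) <= degree G x] neighbours of [x] have fewer than [2 * E * t] low
   neighbours. *)
have [y xy ky] : exists2 y, G x y & 2 * E * t <= #|low_nbrs y|.
  case: (boolP [exists y, G x y && (2 * E * t <= #|low_nbrs y|)]) => [/existsP[y /andP[]]|].
    by exists y.
  rewrite negb_exists => /forallP no; move: lt2.
  have -> : [set y in [set y | G x y] | #|low_nbrs y| < 2 * E * t] = [set y | G x y].
    apply/setP=> y; rewrite !inE ltnNge; have := no y.
    by rewrite negb_and; case: (G x y).
  rewrite ltnNge -/(degree G x) => /negP[]; apply: leq_trans t_le.
  by clear; rewrite expnS expn1; lia.
have cardL v : #|low_nbrs v| <= #|low_nbrs v :\ x| + 1.
  by rewrite (cardsD1 x); lia.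
(* The threshold is [t - 1] because [x] is removed from the low neighbours. The last inequality
   holds by the choice of [M], since [t >= 2 * (4 * e) + 3] gives [2 * (t - 1 - 4 * e) >= t + 1]. *)
apply: (@no_crowded_neighborhood x y (E * t) (t - 1) M) => //.
- apply: leq_trans (ltnW lt1); apply: subset_leq_card; apply/subsetP => u; rewrite !inE.
  by move=> /andP[-> h]; have := cardL u; lia.
- have := cardL y; have : t <= E * t by rewrite leq_pmull.
  lia.
- apply: (@leq_ltn_trans ((14 * (4 * e) + 1) * (degree G x))) => //.
  apply: (@leq_trans ((14 * (4 * e) + 1) * (t.+1 * (2 * E ^ 2)))).
    by rewrite ltn_pmul2l ?addn1.
  rewrite /M; set N := 4 * e in t_ge *.
  have -> : 4 * E ^ 2 * (14 * N + 1) * (t - 1 - N) =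
    (14 * N + 1) * ((2 * (t - 1 - N)) * (2 * E ^ 2)) by lia.
  by rewrite leq_mul2l leq_mul2r; apply/orP; right; apply/orP; right; lia.
Qed.

(** After exchanging the sums, each [y] outside [S] contributes 1, or 0 if it has no low
    neighbour. *)
Lemma card_low_le (E : nat) :
  (forall x, x \in low ->
    (E%:R <= \sum_(y in [set y | G x y]) #|low_nbrs y|%:R^-1 :> rat)%R) ->
  E * #|low| <= #|~: S|.
Proof.
move=> sumE; rewrite -(ler_nat rat) mulnC natrM -sum1_card natr_sum mulr_suml.
apply: (@le_trans _ _ (\sum_(x in low) \sum_(y in [set y | G x y]) #|low_nbrs y|%:R^-1)%R).
  by apply: ler_sum => x /sumE; rewrite mul1r.
rewrite (exchange_big_dep (mem (~: S))) /=; last first.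
  move=> x y xl; rewrite !inE => xy; apply: contraL xy => yS; apply: independentP => //.
  by move: xl; rewrite inE => /andP[].
rewrite -sum1_card natr_sum; apply: ler_sum => y _.
rewrite (eq_bigl (mem (low_nbrs y))); last by move=> x; rewrite !inE adj_sym.
rewrite sumr_const; have [->|k0] := posnP #|low_nbrs y|; first by rewrite mulr0n.
by rewrite -[X in (X <= _)%R]mulr_natr mulVf // pnatr_eq0 -lt0n.
Qed.

(** A vertex of [S] that is not low has degree more than [(e - 1) / e] times the maximum degree, and
    every vertex outside [S] absorbs at most the maximum degree of the edges leaving [S]. *)
Lemma card_high_le : 0 < max_degree G -> (e - 1) * #|S :\: low| <= e * #|~: S|.
Proof.
move=> D0; rewrite -(leq_pmul2l D0).
apply: (@leq_trans (\sum_(v in S :\: low) e * degree G v)).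
  rewrite mulnA mulnC -sum_nat_const; apply: leq_sum => v.
  by rewrite !inE => /andP[+ vS]; rewrite vS /= -ltnNge !mulnBr muln1 mulnC; lia.
rewrite -big_distrr /= mulnCA leq_mul2l; apply/orP; right.
rewrite mulnC -sum_nat_const.
apply: (@leq_trans (\sum_(v in S :\: low) \sum_(w in [set w | G v w]) 1)).
  by apply: leq_sum => v _; rewrite sum1_card.
rewrite (exchange_big_dep (mem (~: S))) /=; last first.
  move=> v w; rewrite !inE => /andP[_ vS]; apply: contraL => wS; exact: independentP.
apply: leq_sum => w _; rewrite sum1dep_card; apply: leq_trans (degree_le_max G w).
by apply: subset_leq_card; apply/subsetP => v; rewrite !inE adj_sym => /andP[].
Qed.

End Discharging.

(** With [e = E + 1], low vertices cost [#|~: S|] and the others [(E + 1) * #|~: S|]. *)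
Lemma critical_independent_le T (G : sgraph T) S E : 0 < E -> critical G -> independent G S ->
  let M := 4 * E ^ 2 * (14 * (4 * E.+1) + 1) in
  2 * E ^ 2 * (2 * (4 * E.+1) + M + 3) <= min_degree G ->
  2 * E.+1 * (4 * E.+1 * (4 * E.+1) + 4 * E.+1 + 16 * M + 10) < max_degree G ->
  E * #|S| <= (E + 2) * #|~: S|.
Proof.
move=> E0 crit indS M hmin hmax.
have hlow : E * #|low G S E.+1| <= #|~: S|.
  apply: card_low_le => // x xl; apply: (sum_inv_low_nbrs (S := S) (e := E.+1)) => //.
  exact: leq_trans hmin (min_degree_le G x).
have := card_high_le E.+1 indS (leq_ltn_trans (leq0n _) hmax); rewrite subSS subn0 => hhigh.
have <- : #|low G S E.+1| + #|S :\: low G S E.+1| = #|S|.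
  rewrite -(cardsID (low G S E.+1) S); congr (_ + _); apply/eq_card => v.
  by rewrite !inE; case: (v \in S).
by rewrite mulnDr; lia.
Qed.

(** * Choice of the constants *)

Local Open Scope ring_scope.

Theorem theorem1p4 (R : realType) (eps : R) (eps_gt0 : 0 < eps) (eps_lt1 : eps < 1) :
  exists d0 D0 : R,
    [/\ 0 < d0, 0 < D0 &
      forall (T : finType) (G : sgraph T),
        critical G ->
        d0 <= (min_degree G)%:R ->
        D0 <= (max_degree G)%:R ->
        (independence_number G)%:R < (1 / 2 + eps) * #|T|%:R].
Proof.
(* [E * eps > 1] makes [(E + 2) / (2 * E + 2) = 1 / 2 + 1 / (2 * E + 2)] smaller than
   [1 / 2 + eps]. *)
pose E := (Num.bound (1 / eps)).+1.
pose M := (4 * E ^ 2 * (14 * (4 * E.+1) + 1))%N.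
exists (2 * E ^ 2 * (2 * (4 * E.+1) + M + 3))%N%:R.
(* The successor turns the weak bound on the maximum degree into the strict one needed. *)
exists (2 * E.+1 * (4 * E.+1 * (4 * E.+1) + 4 * E.+1 + 16 * M + 10)).+1%N%:R.
split; [|by rewrite ltr0n|move=> T G crit].
  by rewrite ltr0n !muln_gt0 /= addn3.
rewrite !ler_nat => hmin hmax.
have nT : (0 < #|T|)%N by case: crit => [[]].
have step (S : {set T}) : independent G S -> #|S|%:R < (1 / 2 + eps) * #|T|%:R.
  move=> indS; have := critical_independent_le (ltn0Sn _) crit indS hmin hmax.
  rewrite -/E -(ler_nat R) !natrM natrD; have /(congr1 (fun k => k%:R : R)) := cardsC S.
  rewrite natrD; have n0 : 0 < #|T|%:R :> R by rewrite ltr0n.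
  have Eeps : 1 < E%:R * eps.
    rewrite -ltr_pdivrMr //; apply: (lt_trans (archi_boundP _)); last by rewrite ltr_nat.
    by rewrite divr_ge0 // ltW.
  move: #|S|%:R #|~: S|%:R #|T|%:R E%:R n0 Eeps => s w n r n0 Eeps cE h.
  have r0 : 0 < r by rewrite -(pmulr_lgt0 _ eps_gt0) (lt_trans ltr01).
  have h1 : (2 * r + 2) * s <= (r + 2) * n by rewrite -cE; nra.
  have h2 : (r + 2) * n < (2 * r + 2) * ((1 / 2 + eps) * n) by nra.
  have h3 : 0 < 2 * r + 2 by nra.
  by rewrite -(ltr_pM2l h3); apply: le_lt_trans h1 h2.
(* The neutral value 0 also satisfies the strict bound, because [G] has a vertex. *)
rewrite /independence_number; elim/big_ind: _ => //.
- by rewrite mulr_gt0 ?ltr0n // addr_gt0 // divr_gt0.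
- by move=> a b ha hb; case: leqP.
Qed.
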